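(* (i) Let $k\in(0,k_{\max})$, and let $\hat q_k=p_{\theta_1,\theta_2}$ where $(\theta_1,\theta_2)$, $\theta_2<0$, is a maximiser of $\frac{k+K(\theta_1,\theta_2)-\theta_1}{\theta_2}$ over $\theta_1\in\mathbb{R},\ \theta_2<0$. Then for all $\epsilon\ge0$, $\gamma\ge0$, every $(\epsilon$-$\gamma)$-almost worst case density $p$ (for threshold $k$) satisfies $$B(p,\hat q_k)\le\gamma-\theta_2\epsilon .$$ (ii) Let $\lambda>0$ with $-1/\lambda\in\Theta_2$, and set $\theta_2:=-1/\lambda$. Then for each density $p$ $$\int Xp\,d\mu+\lambda H(p)\ \ge\ W(\lambda)+\lambda B(p,q_{\theta_2}).$$
   Context: Setup. $\Omega$ is a set with a $\sigma$-algebra and a finite or $\sigma$-finite measure $\mu$; functions on $\Omega$ are measurable and equality of functions is meant $\mu$-a.e. The function $\beta:\Omega\times\mathbb{R}\to(-\infty,+\infty]$ is measurable in $r$ for each $s$; for each $r$, $\beta(r,\cdot)$ is finite, strictly convex and differentiable on $(0,+\infty)$, $\beta(r,0)=\lim_{s\downarrow0}\beta(r,s)$, and $\beta(r,s)=+\infty$ for $s<0$. Put $H(p):=\int_\Omega\beta(r,p(r))\,\mu(dr)$ for $p\ge0$. A density is a nonnegative function $p$ with $\int p\,d\mu=1$. $X:\Omega\to\mathbb{R}$ is measurable, $m$ and $M$ are its $\mu$-essential infimum and supremum, and $p_0$ is a density (the default density) for which $b_0:=\int Xp_0\,d\mu$ exists. Standing assumptions: $-\infty\le m<b_0<M\le+\infty$;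 $H(p)\ge H(p_0)=0$ for every density $p$; and $k_{\max}:=\lim_{b\downarrow m}F(b)>0$, where $$F(b):=\inf\Big\{H(p):\ p\ge 0,\ \int p\,d\mu=1,\ \int Xp\,d\mu=b\Big\}.$$ Also $$V(k):=\inf\Big\{\int Xp\,d\mu:\ p\ge 0,\ \int p\,d\mu=1,\ H(p)\le k\Big\},\qquad W(\lambda):=\inf_{p\text{ density}}\Big[\int Xp\,d\mu+\lambda H(p)\Big].$$ Conventions: $\inf\emptyset=+\infty$; the integrals defining $H$ and $K$ are set to $+\infty$ when not well defined; $\int Xp\,d\mu+\lambda H(p)$ is read as $+\infty$ when $H(p)=+\infty$. Conjugates. $\beta^*(r,\tau):=\sup_{s\in\mathbb{R}}(s\tau-\beta(r,s))$; primes on $\beta,\beta^*$ denote derivatives in the second variable, and $\beta'(r,0),\beta'(r,+\infty)$ are limits of $\beta'(r,s)$ as $s\downarrow0$, $s\uparrow+\infty$. Put $$K(\theta_1,\theta_2):=\int\beta^*(r,\theta_1+\theta_2X(r))\,\mu(dr),\qquad G(\theta_2):=\inf_{\theta_1\in\mathbb{R}}[K(\theta_1,\theta_2)-\theta_1],$$ $\mathrm{dom}\,K:=\{K<+\infty\}$, $\Theta_2$ is the projection of $\mathrm{dom}\,K$ to the $\theta_2$-axis, $\Theta:=\{(\theta_1,\theta_2)\in\mathrm{dom}\,K:\ \theta_1+\theta_2X(r)<\beta'(r,+\infty)\ \mu\text{-a.e.}\}$, and for $(\theta_1,\theta_2)\in\Theta$, $p_{\theta_1,\theta_2}(r):=(\beta^*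 )'(r,\theta_1+\theta_2X(r))$. For each $\theta_2\in\Theta_2$ the infimum defining $G(\theta_2)$ is attained by a unique $\theta_1$, with $(\theta_1,\theta_2)\in\Theta$; with this $\theta_1$ put $q_{\theta_2}:=p_{\theta_1,\theta_2}$. For $k\in(0,k_{\max})$ a maximiser $(\theta_1,\theta_2)$ as in (i) exists and lies in $\Theta$, and then $\hat q_k=p_{\theta_1,\theta_2}=q_{\theta_2}$; this $\hat q_k$ is called the worst case localiser. Bregman distance. For nonnegative $p,q$ on $\Omega$, $B(p,q):=\int\Delta_{\beta(r,\cdot)}(p(r),q(r))\,\mu(dr)$, where $\Delta_f(s,t):=f(s)-f(t)-f'(t)(s-t)$ for $s,t\ge0$; here $f(0)$ and $f'(0)$ are limits at $0$, $0\cdot(\pm\infty)=0$, and if $f(0)=+\infty$ then $\Delta_f(0,0):=0$ and $\Delta_f(s,0):=+\infty$ for $s>0$. For $\epsilon,\gamma\ge0$, an $(\epsilon$-$\gamma)$-almost worst case density (for threshold $k$) is a density $p$ with $H(p)\le k+\gamma$ and $\int Xp\,d\mu\le V(k)+\epsilon$. *)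

(* Defs.v *)
From HB Require Import structures.
From mathcomp Require Import all_boot all_order all_algebra.
From mathcomp Require Import all_classical all_reals all_analysis.
From mathcomp Require Import measurable_realfun ess_sup_inf.

Set Implicit Arguments.
Unset Strict Implicit.
Unset Printing Implicit Defensive.

Import Order.TTheory GRing.Theory Num.Theory.
Import numFieldNormedType.Exports.

Local Open Scope classical_set_scope.
Local Open Scope ring_scope.
Local Open Scope ereal_scope.

Section OneVariable.
Context {R : realType}.
Implicit Types (f : R -> \bar R) (s t tau : R).

(* Finite-valued derivative; meaningful where f is finite near t and
   differentiable at t. *)
Definition dfin f t : R := derive1 (fun u : R => fine (f u)) t.

Definition deriv_ext0 f t : \bar R :=
  if t == 0%R then lim ((dfin f u)%:E @[u --> (0 : R)^'+]) else (dfin f t)%:E.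

(* The product in the last branch uses 0 * (+oo) = 0 * (-oo) = 0. *)
Definition Delta f s t : \bar R :=
  if (t == 0%R) && (f 0%R == +oo) then (if s == 0%R then 0 else +oo)
  else f s - f t - deriv_ext0 f t * (s - t)%:E.

Definition conjugate f tau : \bar R :=
  ereal_sup [set (s * tau)%:E - f s | s in [set: R]].

End OneVariable.

Section Problem.
Context {d : measure_display} {Omega : measurableType d} {R : realType}.
Variable mu : {sigma_finite_measure set Omega -> \bar R}.

Definition integral_defined (f : Omega -> \bar R) : bool :=
  ~~ ((\int[mu]_r f^\+ r == +oo) && (\int[mu]_r f^\- r == +oo)).

(* The library's integral is -oo in the undefined case, because
   +oo - +oo = -oo there. *)
Definition wint (f : Omega -> \bar R) : \bar R :=
  if integral_defined f then \int[mu]_r f r else +oo.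

Record density (p : Omega -> R) : Prop := {
  density_meas : measurable_fun [set: Omega] p ;
  density_ge0 : forall r, (0 <= p r)%R ;
  density_int : \int[mu]_r (p r)%:E = 1 }.

Variable beta : Omega -> R -> \bar R.

Record integrand : Prop := {
  integrand_meas : forall s, measurable_fun [set: Omega] (beta ^~ s) ;
  integrand_ninfty : forall r s, -oo < beta r s ;
  integrand_neg : forall r s, (s < 0)%R -> beta r s = +oo ;
  integrand_fin : forall r s, (0 < s)%R -> beta r s \is a fin_num ;
  integrand_strict_convex : forall r (s t a : R),
    (0 < s)%R -> (0 < t)%R -> s <> t -> (0 < a < 1)%R ->
    beta r (a * s + (1 - a) * t)%R < a%:E * beta r s + (1 - a)%:E * beta r t ;
  integrand_derivable : forall r (s : R), (0 < s)%R ->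
    derivable (fun u : R => fine (beta r u)) s 1%R ;
  integrand_at0 : forall r, beta r s @[s --> (0 : R)^'+] --> beta r 0%R }.

Definition H (p : Omega -> R) : \bar R := wint (fun r => beta r (p r)).

Definition B (p q : Omega -> R) : \bar R :=
  \int[mu]_r Delta (beta r) (p r) (q r).

Variable X : Omega -> R.

(* A density for which the integral does not exist gets the value +oo, hence
   plays no role in the infima below. *)
Definition mean (p : Omega -> R) : \bar R := wint (fun r => (X r * p r)%:E).

Definition F (b : R) : \bar R :=
  ereal_inf [set H p | p in [set p | density p /\ mean p = b%:E]].

Definition V (k : R) : \bar R :=
  ereal_inf [set mean p | p in [set p | density p /\ H p <= k%:E]].

Definition penalised (lambda : R) (p : Omega -> R) : \bar R :=
  if H p == +oo then +oo else mean p + lambda%:E * H p.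

Definition W (lambda : R) : \bar R :=
  ereal_inf [set penalised lambda p | p in [set p | density p]].

Definition m : \bar R := ess_inf mu (EFin \o X).
Definition M : \bar R := ess_sup mu (EFin \o X).

(* Limit of F(b) as b decreases to m; m is never +oo in the setting below. *)
Definition kmax : \bar R :=
  if m is c%:E then lim (F b @[b --> c^'+]) else lim (F b @[b --> -oo%R]).

Definition K (t1 t2 : R) : \bar R :=
  wint (fun r => conjugate (beta r) (t1 + t2 * X r)%R).

Definition G (t2 : R) : \bar R :=
  ereal_inf [set K t1 t2 - t1%:E | t1 in [set: R]].

Definition Theta2 : set R := [set t2 | exists t1, K t1 t2 < +oo].

(* The derivative of the conjugate is meaningful when
   t1 + t2 * X r < beta'(r, +oo). *)
Definition p_ (t1 t2 : R) : Omega -> R :=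
  fun r => dfin (conjugate (beta r)) (t1 + t2 * X r)%R.

(* [get] selects the minimiser t1 in the definition of G t2. *)
Definition q_ (t2 : R) : Omega -> R :=
  p_ (get [set t1 : R | K t1 t2 - t1%:E = G t2]) t2.

Definition dual_objective (k t1 t2 : R) : \bar R :=
  (k%:E + K t1 t2 - t1%:E) * (t2^-1)%:E.

Definition dual_maximiser (k t1 t2 : R) : Prop :=
  (t2 < 0)%R /\
  forall u1 u2 : R, (u2 < 0)%R ->
    dual_objective k u1 u2 <= dual_objective k t1 t2.

Definition almost_worst_case (k epsilon gamma : R) (p : Omega -> R) : Prop :=
  [/\ density p, H p <= (k + gamma)%:E & mean p <= V k + epsilon%:E].

Record standing (p0 : Omega -> R) : Prop := {
  standing_integrand : integrand ;
  standing_X : measurable_fun [set: Omega] X ;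
  standing_density : density p0 ;
  standing_b0_defined : integral_defined (fun r => (X r * p0 r)%:E) ;
  standing_b0 : m < mean p0 < M ;
  standing_H0 : H p0 = 0 ;
  standing_H_min : forall p, density p -> H p0 <= H p ;
  standing_kmax : 0 < kmax }.

End Problem.

(* Main.v *)
Require Import Defs.
From HB Require Import structures.
From mathcomp Require Import all_boot all_order all_algebra.
From mathcomp Require Import all_classical all_reals all_analysis.
From mathcomp Require Import measurable_realfun ess_sup_inf.
From mathcomp Require Import ring lra.

(** Both inequalities follow from one pointwise estimate. Write conj(r, .) for
    the conjugate of beta(r, .) and tau(r) = t1 + t2 X(r). If s maximises s
    tau(r) - beta(r, s), then the derivative of conj(r, .) at tau(r) is s
    ([conjugate_deriv]), and since the slope of beta(r, .) at s is tau(r), or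
    at least tau(r) when s = 0, Delta(p(r), s) is at most the gap beta(r, p(r))
    + conj(r, tau(r)) - tau(r) p(r) in the Fenchel-Young inequality
    ([Delta_le]). Integrating over a density p gives [Bregman_le]: B(p, p_(t1,
    t2)) <= H(p) + K(t1, t2) - t1 - t2 mean(p). Two things remain: that a
    maximiser exists for almost every r, and that K(t1, t2) - t1 is small
    enough, that is, strong duality.

    Existence of maximisers. If t1 minimises K(., t2) - t1, then lowering t1 by
    e lowers K by at most e. Where the supremum defining conj(r, tau(r)) is
    approached only at infinity, the conjugate has infinite left slope, so this
    set is null ([unattained_bound], [ae_maximiser]).

    Strong duality. The primal problems are studied on budgets: pairs (p, g)
    with p nonnegative and g a real integrable bound of the cost density
    beta(r, p(r)). Mass, moment and cost are linear on this convex set, so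
    Lagrange multipliers come from separation in the plane, one constraint at a
    time ([supporting_line], [cost_multiplier], [mass_multiplier]). The result
    is a lower bound for the integral of (X - nu) p + lam g over all budgets.
    Patching almost pointwise optimal values into the default density p0 on
    sets where everything is bounded moves the infimum under the integral
    ([interchange]), which for lam > 0 yields a bound on K at (nu / lam, -1 /
    lam) ([strong_duality]).

    For the penalised problem lam = lambda is given, and the resulting t1
    attains the infimum defining G. For the problem with threshold k, the case
    lam = 0 has to be excluded: it would give v <= nu <= m for the primal value
    v ([degenerate_multiplier]), whereas k < kmax gives some b1 > m with F(b1)
    > k ([lt_kmax_lt_F]), and then v >= b1. *)

Import Order.TTheory GRing.Theory Num.Theory.
Import numFieldNormedType.Exports.

Local Open Scope classical_set_scope.
Local Open Scope ring_scope.
Local Open Scope ereal_scope.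

(** * Convex costs of one variable *)

Section OneVariableCost.
Set Implicit Arguments.
Unset Strict Implicit.
Context {R : realType}.
Implicit Types (f : R -> \bar R) (s t tau a x y z e : R).

(** What [integrand] says about beta(r, .) for one fixed r. *)
Record cost f : Prop := {
  cost_ninfty : forall s, -oo < f s ;
  cost_neg : forall s, (s < 0)%R -> f s = +oo ;
  cost_fin : forall s, (0 < s)%R -> f s \is a fin_num ;
  cost_strict_convex : forall s t a,
    (0 < s)%R -> (0 < t)%R -> s <> t -> (0 < a < 1)%R ->
    f (a * s + (1 - a) * t)%R < a%:E * f s + (1 - a)%:E * f t ;
  cost_derivable : forall s, (0 < s)%R ->
    derivable (fun u : R => fine (f u)) s 1%R ;
  cost_at0 : f s @[s --> (0 : R)^'+] --> f 0%R }.

Lemma cost_right_cvg f s : cost f -> (0 <= s)%R -> f x @[x --> s^'+] --> f s.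
Proof.
move=> cf; rewrite le_eqVlt => /orP[/eqP <-|s0]; first exact: cost_at0.
have fs : {for s, continuous (fine \o f)}.
  exact/differentiable_continuous/derivable1_diffP/cost_derivable.
rewrite -(fineK (cost_fin cf s0)); apply: cvg_EFin; last first.
  exact: cvg_at_right_filter.
near=> x; apply: cost_fin => //; apply: lt_trans s0 _; near: x.
exact: nbhs_right_gt.
Unshelve. all: by end_near. Qed.

Lemma cost_right_lt f s (w : \bar R) : cost f -> (0 <= s)%R -> f s < w ->
  exists2 e : R, (0 < e)%R & forall h, (0 < h < e)%R -> f (s + h)%R < w.
Proof.
move=> cf s0 fw.
have nw : nbhs (f s) [set y | y < w].
  by apply: open_nbhs_nbhs; split=> //; exact: open_ereal_lt_ereal.
have /nbhs_right0P := cost_right_cvg cf s0 nw.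
move=> -[e /= e0 he]; exists e => // h /andP[h0 hlt].
by apply: he => //=; rewrite sub0r normrN gtr0_norm.
Qed.

Lemma cost_right_gt f s (w : \bar R) : cost f -> (0 <= s)%R -> w < f s ->
  exists2 e : R, (0 < e)%R & forall h, (0 < h < e)%R -> w < f (s + h)%R.
Proof.
move=> cf s0 fw.
have nw : nbhs (f s) [set y | w < y].
  by apply: open_nbhs_nbhs; split=> //; exact: open_ereal_gt_ereal.
have /nbhs_right0P := cost_right_cvg cf s0 nw.
move=> -[e /= e0 he]; exists e => // h /andP[h0 hlt].
by apply: he => //=; rewrite sub0r normrN gtr0_norm.
Qed.

(** Convexity is assumed on the open half-line only. Both points are moved to
    the right by a small h, and right continuity on [0, +oo) lets h tend to 0;
    strictness is lost in the limit. The values are replaced by real upper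
    bounds x and y, so that a value +oo at 0 needs no separate treatment. *)
Lemma cost_convex f s t a x y : cost f -> (0 <= s)%R -> (0 <= t)%R ->
  (0 < a < 1)%R -> f s <= x%:E -> f t <= y%:E ->
  f (a * s + (1 - a) * t)%R <= (a * x + (1 - a) * y)%:E.
Proof.
move=> cf s0 t0 /andP[a0 a1] fx fy; rewrite leNgt; apply/negP => lt.
have [eta eta0 lte] : exists2 eta : R, (0 < eta)%R &
    (a * x + (1 - a) * y + eta)%:E < f (a * s + (1 - a) * t)%R.
  move: lt (cost_ninfty cf (a * s + (1 - a) * t)%R).
  case: (f _) => [w| |] //; rewrite ?lte_fin => lt _.
    exists ((w - (a * x + (1 - a) * y)) / 2)%R; rewrite ?lte_fin; lra.
  by exists 1%R; rewrite ?ltry.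
have w0 : (0 <= a * s + (1 - a) * t)%R by nra.
have [e1 e10 h1] := cost_right_gt cf w0 lte.
have fx' : f s < (x + eta)%:E by apply: le_lt_trans fx _; rewrite lte_fin; lra.
have fy' : f t < (y + eta)%:E by apply: le_lt_trans fy _; rewrite lte_fin; lra.
have [e2 e20 h2] := cost_right_lt cf s0 fx'.
have [e3 e30 h3] := cost_right_lt cf t0 fy'.
pose h := (Num.min e1 (Num.min e2 e3) / 2)%R.
have m0 : (0 < Num.min e1 (Num.min e2 e3))%R by rewrite !lt_min e10 e20.
have [m1 m2 m3] : [/\ Num.min e1 (Num.min e2 e3) <= e1,
    Num.min e1 (Num.min e2 e3) <= e2 & Num.min e1 (Num.min e2 e3) <= e3]%R.
  by rewrite !ge_min !lexx !orbT.
have h0 : (0 < h)%R by rewrite /h; lra.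
have k1 := h1 h ltac:(by rewrite h0 /h; lra).
have k2 := h2 h ltac:(by rewrite h0 /h; lra).
have k3 := h3 h ltac:(by rewrite h0 /h; lra).
suff : f (a * s + (1 - a) * t + h)%R <= (a * x + (1 - a) * y + eta)%:E.
  by rewrite leNgt; move: k1 => /= ->.
have sh0 : (0 < s + h)%R by lra.
have th0 : (0 < t + h)%R by lra.
move: k2 k3 => /=.
rewrite -(fineK (cost_fin cf sh0)) -(fineK (cost_fin cf th0)) !lte_fin.
move=> k2 k3.
have [st|/eqP st] := eqVneq s t.
  rewrite st in k2 *; have -> : (a * t + (1 - a) * t + h = t + h)%R by ring.
  by rewrite -(fineK (cost_fin cf th0)) lee_fin; nra.
have -> : (a * s + (1 - a) * t + h = a * (s + h) + (1 - a) * (t + h))%R.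
  by ring.
apply/ltW/(lt_le_trans (cost_strict_convex cf sh0 th0 _ _)).
- by move=> /addIr.
- by rewrite a0.
rewrite -(fineK (cost_fin cf sh0)) -(fineK (cost_fin cf th0)) -!EFinM -EFinD.
by rewrite lee_fin; nra.
Qed.

End OneVariableCost.

(** * Conjugates and their maximisers *)

Section ConjugateOfCost.
Set Implicit Arguments.
Unset Strict Implicit.
Context {R : realType}.
Implicit Types (f : R -> \bar R) (s t tau a x y z e : R).

Lemma conjugate_ge f tau s : (s * tau)%:E - f s <= conjugate f tau.
Proof. by apply: ereal_sup_ubound; exists s. Qed.

Lemma conjugate_ge_fin f tau s y : f s <= y%:E ->
  (s * tau - y)%:E <= conjugate f tau.
Proof.
move=> fy; apply: le_trans (conjugate_ge f tau s).
by rewrite EFinB leeB.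
Qed.

Lemma conjugate_gtNy f tau : cost f -> -oo < conjugate f tau.
Proof.
move=> cf; have f1 := cost_fin cf (@ltr01 R).
by apply: lt_le_trans (@conjugate_ge_fin f tau 1 (fine (f 1%R)) _);
  rewrite ?ltNyr ?fineK.
Qed.

Lemma conjugate_le f tau (w : \bar R) : cost f -> -oo < w ->
  (forall s y, (0 <= s)%R -> f s = y%:E -> (s * tau - y)%:E <= w) ->
  conjugate f tau <= w.
Proof.
move=> cf w0 H; apply: ge_ereal_sup => _ [s _ <-].
have [s0|s0] := ltP s 0%R; first by rewrite (cost_neg cf s0) leNye.
case fs : (f s) (cost_ninfty cf s) => [y| |] // _; last by rewrite leNye.
by rewrite -EFinB; apply: H.
Qed.

(** An enumeration with repetitions: codes that are not those of positive
    rationals are sent to 1. *)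
Definition positive_rational (n : nat) : R :=
  if unpickle n is Some q then (if 0 < ratr q :> R then ratr q else 1)%R
  else 1%R.

Lemma positive_rational_gt0 n : (0 < positive_rational n)%R.
Proof.
rewrite /positive_rational; case: unpickle => [q|] //.
by case: ifPn.
Qed.

Lemma positive_rational_dense s t : (0 <= s < t)%R ->
  exists n, (s < positive_rational n < t)%R.
Proof.
move=> /andP[s0 st]; have [q] := rat_in_itvoo st.
rewrite in_itv /= => /andP[sq qt]; exists (pickle q).
by rewrite /positive_rational pickleK (le_lt_trans s0 sq) sq.
Qed.

(** Suprema over countably many points are measurable in r and can be
    approached by finitely many choices. Right continuity of f makes the
    positive rationals sufficient, including for the value at 0. *)
Lemma conjugate_le_rational f tau (w : \bar R) : cost f ->
  (forall n, (positive_rational n * tau)%:E - f (positive_rational n) <= w) ->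
  conjugate f tau <= w.
Proof.
move=> cf H.
have Hr n (y : R) : f (positive_rational n) = y%:E ->
    (positive_rational n * tau - y)%:E <= w.
  by move=> fy; have := H n; rewrite fy.
have w0 : -oo < w.
  have := Hr 0%N _ (esym (fineK (cost_fin cf (positive_rational_gt0 0)))).
  by apply: lt_le_trans; rewrite ltNyr.
apply: conjugate_le => // s y s0 fs; rewrite leNgt; apply/negP => ws.
have [v wv] : exists v : R, w = v%:E.
  by move: w0 ws; case: (w) => [v| |] // _ _; exists v.
move: ws; rewrite wv lte_fin => vs.
(* Half of the gap is for the variation of f, half for that of x tau. *)
pose g := ((s * tau - y - v) / 2)%R; have g0 : (0 < g)%R by rewrite /g; lra.
have fl : f s < (y + g)%:E by rewrite fs lte_fin; lra.
have [e e0 he] := cost_right_lt cf s0 fl.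
pose k := (g / (`|tau| + 1))%R.
have tau0 : (0 <= `|tau|)%R by [].
have k0 : (0 < k)%R by rewrite divr_gt0 //; lra.
have me0 : (0 < Num.min e k)%R by rewrite lt_min e0.
have [n] := @positive_rational_dense s (s + Num.min e k) ltac:(by rewrite s0; lra).
set q := positive_rational n => /andP[sq].
rewrite -ltrBlDl lt_min => /andP[qe qk].
have hq : (0 < q - s < e)%R by rewrite qe andbT subr_gt0.
have := he _ hq; rewrite addrC subrK.
have q0 : (0 < q)%R by exact: positive_rational_gt0.
rewrite -(fineK (cost_fin cf q0)) lte_fin => fq.
have := Hr n _ (esym (fineK (cost_fin cf q0))).
rewrite -/q wv lee_fin.
have : (`|(q - s) * tau| <= g)%R.
  rewrite normrM gtr0_norm; last by lra.
  have : (k * (`|tau| + 1) = g)%R by rewrite /k divfK //; apply: lt0r_neq0; lra.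
  nra.
rewrite ler_norml => /andP[].
rewrite /g in g0 fq *; lra.
Qed.

Definition maximiser f tau s : Prop :=
  [/\ (0 <= s)%R, f s \is a fin_num & conjugate f tau = (s * tau)%:E - f s].

Lemma maximiserP f tau s x y : maximiser f tau s -> f x <= y%:E ->
  (x * tau - y <= s * tau - fine (f s))%R.
Proof.
move=> [s0 fs cs] fx; rewrite -lee_fin.
apply: le_trans (conjugate_ge_fin tau fx) _.
by rewrite cs EFinB fineK.
Qed.

Lemma maximiserI f tau s y : cost f -> (0 <= s)%R -> f s = y%:E ->
  (forall x z, (0 <= x)%R -> f x = z%:E -> (x * tau - z <= s * tau - y)%R) ->
  maximiser f tau s.
Proof.
move=> cf s0 fs H; split; rewrite ?fs //.
apply/eqP; rewrite eq_le; apply/andP; split.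
  by apply: conjugate_le; rewrite -?EFinB ?ltNyr.
by rewrite -fs conjugate_ge.
Qed.

(** If x did as well as s, so would their midpoint w, by concavity; strict
    concavity between w and the larger of x and s, both positive, would then
    give a point doing better than the maximum. *)
Lemma maximiser_unique f tau s x y : cost f -> maximiser f tau s ->
  (0 <= x)%R -> x <> s -> f x <= y%:E ->
  (x * tau - y < s * tau - fine (f s))%R.
Proof.
move=> cf ms x0 xs fx; have [s0 fs _] := ms.
rewrite ltNge; apply/negP => le.
have fs' : f s <= (fine (f s))%:E by rewrite fineK.
have zs : (0 < Num.max x s)%R.
  by rewrite ltNge; apply/negP; rewrite ge_max => /andP[xl sl]; apply: xs; lra.
pose w := (1/2 * x + (1 - 1/2) * s)%R.
have h2 : (0 < (1/2 : R) < 1)%R by lra.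
have fw := cost_convex cf x0 s0 h2 fx fs'.
have w0 : (0 < w)%R by move: zs; rewrite /w lt_max => /orP[]; lra.
set z := Num.max x s in zs.
have fz : exists2 c, f z <= c%:E & (s * tau - fine (f s) <= z * tau - c)%R.
  rewrite /z; case: leP => _; first by exists (fine (f s)).
  by exists y.
have [c fc cle] := fz.
have wz : w <> z.
  by rewrite /w /z; case: leP => ? ?; apply: xs; lra.
have := cost_strict_convex cf w0 zs wz h2.
have v0 : (0 < 1/2 * w + (1 - 1/2) * z)%R by lra.
rewrite -(fineK (cost_fin cf w0)) -(fineK (cost_fin cf zs)).
rewrite -(fineK (cost_fin cf v0)) -!EFinM -EFinD lte_fin.
move: fw fc; rewrite -/w -(fineK (cost_fin cf w0)) -(fineK (cost_fin cf zs)) !lee_fin => fw fc lt.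
have fv' : f (1/2 * w + (1 - 1/2) * z)%R <= (fine (f (1/2 * w + (1 - 1/2) * z)%R))%:E.
  by rewrite fineK // cost_fin.
have := maximiserP ms fv'.
rewrite /w in lt fw *; nra.
Qed.

(** The loss at distance exactly e from s is positive by uniqueness, and by
    concavity the loss grows at least linearly from there on. The condition on
    e keeps s - e in the region where f is finite, unless there is nothing to
    the left of s. *)
Lemma maximiser_gap f tau s e : cost f -> maximiser f tau s -> (0 < e)%R ->
  s = 0%R \/ (e < s)%R ->
  exists2 c : R, (0 < c)%R & forall x y, (0 <= x)%R -> f x <= y%:E ->
    (e <= `|x - s|)%R -> (x * tau - y <= s * tau - fine (f s) - c * `|x - s|)%R.
Proof.
move=> cf ms e0 es; have [s0 fs _] := ms.
have fs' : f s <= (fine (f s))%:E by rewrite fineK.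

have side t : (0 < t)%R -> (e = `|t - s|)%R -> exists2 c : R, (0 < c)%R &
    forall x y, (0 <= x)%R -> f x <= y%:E -> (e <= `|x - s|)%R ->
    (0 <= (x - s) * (t - s))%R ->
    (x * tau - y <= s * tau - fine (f s) - c * `|x - s|)%R.
  move=> t0 et; have ft := cost_fin cf t0.
  have ft' : f t <= (fine (f t))%:E by rewrite fineK.
  have ts : t <> s by move=> ts; move: et; rewrite ts subrr normr0 => /eqP; rewrite gt_eqF.
  have drop := maximiser_unique cf ms (ltW t0) ts ft'.
  exists (((s * tau - fine (f s)) - (t * tau - fine (f t))) / e)%R.
    by rewrite divr_gt0 // subr_gt0.
  move=> x y x0 fx ex sgn.
  have d0 : (0 < `|x - s|)%R by apply: lt_le_trans e0 ex.
  pose a := (e / `|x - s|)%R.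
  have aE : (a * (x - s) = t - s)%R.
    rewrite /a; have [xs|xs] := ltP 0%R (x - s)%R.
      rewrite gtr0_norm // divfK; last by rewrite gt_eqF.
      by rewrite et ger0_norm //; nra.
    have xs' : (x - s < 0)%R.
      by rewrite lt_neqAle xs andbT; apply/eqP => xs0; move: d0; rewrite xs0 normr0 ltxx.
    rewrite ltr0_norm // invrN mulrN mulNr divfK; last by rewrite lt_eqF.
    by rewrite et ler0_norm ?opprK //; nra.
  have [a1|a1] := eqVneq a 1%R.
    have xt : x = t by move: aE; rewrite a1; lra.
    have de : (`|x - s| = e)%R by rewrite xt -et.
    rewrite de divfK ?gt_eqF //.
    by move: fx; rewrite xt -(fineK ft) lee_fin; lra.
  have a01 : (0 < a < 1)%R.
    rewrite divr_gt0 //= lt_neqAle a1 /= /a ler_pdivrMr // mul1r.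
    exact: ex.
  have := cost_convex cf x0 s0 a01 fx fs'.
  have -> : (a * x + (1 - a) * s = t)%R by move: aE; lra.
  rewrite -(fineK ft) lee_fin => cv.
  have -> : ((s * tau - fine (f s) - (t * tau - fine (f t))) / e * `|x - s| =
     (s * tau - fine (f s) - (t * tau - fine (f t))) / a)%R.
    rewrite /a invf_div; field.
    by rewrite !gt_eqF.
  move: a01 => /andP[a0 _].
  rewrite lerBrDr -lerBrDl ler_pdivrMr //.
  have tE : (t * tau = a * x * tau + (1 - a) * s * tau)%R.
    have -> : t = (a * (x - s) + s)%R by lra.
    by ring.
  by nra.
have [c1 c10 h1] := side (s + e)%R ltac:(lra) ltac:(by rewrite addrC addKr gtr0_norm).
case: es => [es|es].
  exists c1 => // x y x0 fx ex; apply: h1 => //.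
  by rewrite es; nra.
have [c2 c20 h2] := side (s - e)%R ltac:(lra)
  ltac:(by rewrite addrC addKr normrN gtr0_norm).
exists (Num.min c1 c2); first by rewrite lt_min c10.
move=> x y x0 fx ex.
have d0 : (0 <= `|x - s|)%R by [].
have [m1 m2] : (Num.min c1 c2 <= c1 /\ Num.min c1 c2 <= c2)%R.
  by rewrite !ge_min !lexx orbT.
have [xs|xs] := leP s x.
  have := h1 x y x0 fx ex ltac:(nra); nra.
have := h2 x y x0 fx ex ltac:(nra); nra.
Qed.

End ConjugateOfCost.

(** * Derivative of the conjugate and the Bregman integrand *)

Section DualityOneVariable.
Set Implicit Arguments.
Unset Strict Implicit.
Context {R : realType}.
Implicit Types (f : R -> \bar R) (s t tau a x y z e : R).

(** An envelope argument: changing tau by h changes the objective at x by h x.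
    With |h| below the slope c of [maximiser_gap], points farther than e from s
    cannot overtake s, so the conjugate at tau + h lies between v + h s and v +
    h s + e |h|. *)
Lemma conjugate_deriv f tau s : cost f -> maximiser f tau s ->
  dfin (conjugate f) tau = s.
Proof.
move=> cf ms; have [s0 fs cs] := ms.
have fs' : f s <= (fine (f s))%:E by rewrite fineK.
pose v := (s * tau - fine (f s))%R.
have cv : conjugate f tau = v%:E by rewrite cs /v EFinB fineK.
have low h : (v + h * s)%:E <= conjugate f (h + tau)%R.
  apply: le_trans (conjugate_ge_fin _ fs').
  by rewrite lee_fin /v; lra.
have up e : (0 < e)%R -> (s = 0 \/ e < s)%R -> exists2 c : R, (0 < c)%R & forall h,
    (`|h| <= c)%R -> conjugate f (h + tau)%R <= (v + h * s + e * `|h|)%:E.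
  move=> e0 es; have [c c0 gap] := maximiser_gap cf ms e0 es.
  exists c => // h hc; apply: conjugate_le => // [|x y x0 fx].
    by rewrite ltNyr.
  have fx' : f x <= y%:E by rewrite fx.
  rewrite lee_fin.
  have -> : (x * (h + tau) - y = x * tau - y + h * s + h * (x - s))%R by ring.
  have hx : (h * (x - s) <= `|h| * `|x - s|)%R.
    by rewrite -normrM; apply: ler_norm.
  have h0 : (0 <= `|h|)%R by [].
  have [ex|ex] := leP e `|x - s|%R.
    have := gap x y x0 fx' ex; rewrite /v; nra.
  have := maximiserP ms fx'; rewrite /v.
  have : (`|h| * `|x - s| <= `|h| * e)%R by rewrite ler_wpM2l // ltW.
  lra.
rewrite /dfin /derive1; apply: cvg_lim => //.
apply/cvgrPdist_le => e e0.
have [e' [e'0 e'e e's]] : exists e' : R, [/\ 0 < e', e' <= e & s = 0 \/ e' < s]%R.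
  have [->|sn0] := eqVneq s 0%R; first by exists e; split=> //; left.
  have sp : (0 < s)%R by rewrite lt_neqAle eq_sym sn0.
  exists (Num.min e (s / 2))%R; split.
  - by rewrite lt_min e0 divr_gt0.
  - by rewrite ge_min lexx.
  - by right; rewrite gt_min; apply/orP; right; lra.
have [c c0 hc] := up e' e'0 e's.
near=> h.
have hn0 : h != 0%R by near: h; exact: nbhs_dnbhs_neq.
have hlec : (`|h| <= c)%R.
  by near: h; apply: dnbhs0_le.
have h1 := low h; have h2 := hc h hlec.
have [w cw] : exists w, conjugate f (h + tau)%R = w%:E.
  move: h1 h2; case: conjugate => [w| |] // _ _; by exists w.
rewrite cw cv /=; move: h1 h2; rewrite cw !lee_fin => h1 h2.
have np : (0 < `|h|)%R by rewrite normr_gt0.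
rewrite -(ler_pM2r np) -normrM.
have -> : ((s - h^-1 *: (w - v)) * h = s * h - (w - v))%R.
  by rewrite mulrBl /GRing.scale /= mulrAC mulVf // mul1r.
rewrite ler_norml; apply/andP; split; nra.
Unshelve. all: by end_near. Qed.

Lemma cost_deriv_cvg f s : cost f -> (0 < s)%R ->
  (fun h => h^-1 * (fine (f (h + s)%R) - fine (f s)))%R h @[h --> (0%R : R)^']
    --> dfin f s.
Proof.
move=> cf s0; move: (cost_derivable cf s0).
rewrite /dfin derive1E /derivable /derive => dv; apply: cvg_trans dv.
apply: near_eq_cvg; near=> h.
by rewrite /GRing.scale /= mulr1.
Unshelve. all: by end_near. Qed.

Lemma cost_deriv_near f s e : cost f -> (0 < s)%R -> (0 < e)%R ->
  exists2 c : R, (0 < c)%R & forall h : R, (`|h| < c)%R ->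
    (`|fine (f (h + s)%R) - fine (f s) - dfin f s * h| <= e * `|h|)%R.
Proof.
move=> cf s0 e0; have /cvgrPdist_le/(_ e e0) := cost_deriv_cvg cf s0.
move=> [c /= c0 hc]; exists c => // h hlt.
have [->|h0] := eqVneq h 0%R.
  by rewrite add0r subrr mulr0 subrr normr0 mulr0.
have := hc h; rewrite /= sub0r normrN => /(_ hlt h0).
have np : (0 < `|h|)%R by rewrite normr_gt0.
rewrite -(ler_pM2r np) -normrM mulrBl mulrAC mulVf // mul1r distrC.
by [].
Qed.

(** By convexity the difference quotients at s in the direction of x are at
    most (y - f s) / |x - s|, and they converge to the derivative. *)
Lemma cost_tangent f s x y : cost f -> (0 < s)%R -> (0 <= x)%R ->
  f x <= y%:E -> (dfin f s * (x - s) <= y - fine (f s))%R.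
Proof.
move=> cf s0 x0 fx; have fs := cost_fin cf s0.
have fs' : f s <= (fine (f s))%:E by rewrite fineK.
have [xs|xs] := eqVneq x s.
  by move: fx; rewrite xs subrr mulr0 -(fineK fs) lee_fin; lra.
have d0 : (0 < `|x - s|)%R by rewrite normr_gt0 subr_eq0.
rewrite leNgt; apply/negP => lt.
pose g := (dfin f s * (x - s) - (y - fine (f s)))%R.
have g0 : (0 < g)%R by rewrite /g; lra.
have [c c0 hc] := cost_deriv_near cf s0 (divr_gt0 g0 (mulr_gt0 (ltr0Sn R 1) d0)).
pose a := Num.min (1 / 2)%R (c / (2 * `|x - s|))%R.
have a0 : (0 < a)%R by rewrite lt_min !divr_gt0 ?mulr_gt0.
have a1 : (a < 1)%R by rewrite gt_min; apply/orP; left; lra.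
have ac : (a * `|x - s| < c)%R.
  have : (a <= c / (2 * `|x - s|))%R by rewrite ge_min lexx orbT.
  rewrite ler_pdivlMr ?mulr_gt0 //; lra.
have := hc (a * (x - s))%R; rewrite normrM (gtr0_norm a0) => /(_ ac).
have a01 : (0 < a < 1)%R by rewrite a0.
have := cost_convex cf x0 (ltW s0) a01 fx fs'.
have -> : (a * x + (1 - a) * s = a * (x - s) + s)%R by ring.
have p0 : (0 < a * (x - s) + s)%R by nra.
rewrite -(fineK (cost_fin cf p0)) lee_fin => cv.
have -> : (g / (2 * `|x - s|) * (a * `|x - s|) = a * (g / 2))%R.
  by field; rewrite gt_eqF.
rewrite ler_norml => /andP[+ _]; rewrite /g in g0 *; nra.
Qed.

Lemma cost_deriv_unique f s l : cost f -> (0 < s)%R ->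
  (forall x y, (0 <= x)%R -> f x = y%:E -> (l * (x - s) <= y - fine (f s))%R) ->
  dfin f s = l.
Proof.
move=> cf s0 H; apply/eqP/negPn/negP => ne.
(* Within half the distance of the slopes, a small step to the left or to the
   right contradicts H. *)
have e0 : (0 < `|dfin f s - l| / 2)%R by rewrite divr_gt0 // normr_gt0 subr_eq0.
have [c c0 hc] := cost_deriv_near cf s0 e0.
pose k := (Num.min c s / 2)%R.
have m0 : (0 < Num.min c s)%R by rewrite lt_min c0.
have [m1 m2] : (Num.min c s <= c /\ Num.min c s <= s)%R.
  by rewrite !ge_min !lexx orbT.
have k0 : (0 < k)%R by rewrite /k; lra.
have point (h : R) : (`|h| = k)%R ->
    (l * h <= dfin f s * h + `|dfin f s - l| / 2 * k)%R.
  move=> hk.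
  have hlt : (`|h| < c)%R by rewrite hk /k; lra.
  have p0 : (0 < h + s)%R.
    by move: (ler_norm (- h)); rewrite normrN hk /k; lra.
  have := H (h + s)%R _ (ltW p0) (esym (fineK (cost_fin cf p0))).
  have := hc h hlt; rewrite hk ler_norml => /andP[_]; rewrite addrK; lra.
have := point k (gtr0_norm k0).
have := point (- k)%R; rewrite normrN => /(_ (gtr0_norm k0)).
have [dl|dl] := leP l (dfin f s).
  rewrite ger0_norm ?subr_ge0 //.
  have : (l < dfin f s)%R by rewrite lt_neqAle eq_sym ne.
  nra.
rewrite ltr0_norm ?subr_lt0 //; nra.
Qed.

Lemma maximiser_deriv f tau s : cost f -> maximiser f tau s -> (0 < s)%R ->
  dfin f s = tau.
Proof.
move=> cf ms s0; apply: cost_deriv_unique => // x y x0 fx.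
have fx' : f x <= y%:E by rewrite fx.
have := maximiserP ms fx'; lra.
Qed.

(** At the boundary point 0 maximality only says that f lies above the line of
    slope tau through (0, f 0). By the tangent inequality the derivatives at
    positive points are then at least tau, and they decrease to their limit. *)
Lemma maximiser0_deriv f tau : cost f -> maximiser f tau 0%R ->
  exists2 l : R, deriv_ext0 f 0%R = l%:E & (tau <= l)%R.
Proof.
move=> cf m0; have [_ f0 _] := m0.
have f0' : f 0%R <= (fine (f 0%R))%:E by rewrite fineK.
have nd : {in `]0, 1[%R &, {homo (fun u : R => (dfin f u)%:E) : u v / (u <= v)%R >-> u <= v}}.
  move=> u v; rewrite !in_itv /= => /andP[u0 _] /andP[v0 _] uv.
  have fu : f u <= (fine (f u))%:E by rewrite fineK // cost_fin.
  have fv : f v <= (fine (f v))%:E by rewrite fineK // cost_fin.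
  have := cost_tangent cf u0 (ltW v0) fv.
  have := cost_tangent cf v0 (ltW u0) fu.
  move: uv; rewrite le_eqVlt => /orP[/eqP ->//|uv].
  rewrite lee_fin; nra.
have lo (u : R) : (0 < u)%R -> (tau <= dfin f u)%R.
  move=> u0; have fu : f u <= (fine (f u))%:E by rewrite fineK // cost_fin.
  have := cost_tangent cf u0 (lexx _) f0'.
  have := maximiserP m0 fu; nra.
have i01 : (BRight (0%R : R) < BLeft (1%R : R))%O by rewrite bnd_simp.
have cv := nondecreasing_at_right_cvge _ i01 nd.
rewrite /deriv_ext0 eqxx (cvg_lim _ cv) //.
set I := ereal_inf _.
have Ilo : tau%:E <= I.
  apply: le_ereal_inf_tmp => _ [u /= + <-]; rewrite in_itv /= => /andP[u0 _].
  by rewrite lee_fin lo.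
have Iup : I <= (dfin f (1/2))%:E.
  apply: ereal_inf_lbound; exists (1/2)%R => //=.
  by rewrite in_itv /=; apply/andP; split; lra.
by move: Ilo Iup; case: I => [l| |] // Ilo _; exists l.
Qed.

(** The tangent slope of f at s is tau when s > 0, and at least tau when s = 0.
    Replacing it by tau can only increase Delta, and turns it into the gap in
    the Fenchel-Young inequality. *)
Lemma Delta_le f tau s x y : cost f -> maximiser f tau s -> (0 <= x)%R ->
  f x <= y%:E ->
  Delta f x s <= (y + fine (conjugate f tau) - tau * x)%:E.
Proof.
move=> cf ms x0 fx; have [s0 fs cs] := ms.
rewrite /Delta; case: ifPn => [/andP[/eqP s00 /eqP foo]|_].
  by move: fs; rewrite s00 foo.
have [l -> ltau] : exists2 l : R, deriv_ext0 f s = l%:E & (tau * (x - s) <= l * (x - s))%R.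
  have [s00|sn0] := eqVneq s 0%R.
    have [l lE tl] := maximiser0_deriv cf (eq_ind _ (maximiser f tau) ms _ s00).
    by exists l; rewrite s00 // subr0 ler_wpM2r.
  have sp : (0 < s)%R by rewrite lt_neqAle eq_sym sn0.
  by exists tau; rewrite // /deriv_ext0 (negbTE sn0) (maximiser_deriv cf ms).
rewrite cs.
have [z fz] : exists z, f s = z%:E by exists (fine (f s)); rewrite fineK.
rewrite fz -EFinM; apply: (@le_trans _ _ (y%:E - z%:E - (l * (x - s))%:E)).
  by apply: leeB => //; apply: leeB.
by rewrite -!EFinB /= lee_fin; lra.
Qed.

(** Compactness of [0, b] when f is finite at 0. Otherwise the objective tends
    to -oo at 0, so a small interval [0, c] can be discarded in favour of the
    point a. *)
Lemma maximiser_exists_on f tau (a b : R) : cost f -> (0 < a < b)%R ->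
  exists2 s : R, (0 <= s <= b)%R & f s \is a fin_num /\
    forall x y, (0 <= x <= b)%R -> f x = y%:E ->
      (x * tau - y <= s * tau - fine (f s))%R.
Proof.
move=> cf /andP[a0 ab].
pose u x := (x * tau - fine (f x))%R.
have cu x : (0 < x)%R -> {for x, continuous u}.
  move=> x0; apply: continuousB; first exact: mulrr_continuous.
  exact/differentiable_continuous/derivable1_diffP/cost_derivable.
have cun (c : R) : (0 <= c < b)%R -> u x @[x --> c^'+] --> u c ->
    exists2 s : R, (c <= s <= b)%R &
      forall t, (c <= t <= b)%R -> (u t <= u s)%R.
  move=> /andP[c0 cb] uc.
  have : {within `[c, b], continuous u}.
    apply/(continuous_within_itvP _ cb); split=> //.
      move=> x; rewrite in_itv /= => /andP[cx _].
      by apply: cu; apply: le_lt_trans cx.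
    by apply: cvg_at_left_filter; apply: cu; apply: lt_trans ab.
  move=> /(EVT_max (ltW cb))[s]; rewrite in_itv /= => sI smax.
  by exists s => // t tI; apply: smax; rewrite in_itv.
case f0 : (f 0%R) (cost_ninfty cf 0%R) => [z| |] // _.
  have [||s sI smax] := cun 0%R.
  - by rewrite lexx (lt_trans a0).
  - apply: cvgB; first by apply: cvg_at_right_filter; exact: mulrr_continuous.
    rewrite f0; apply: fine_cvg; rewrite -f0; exact: cost_at0.
  exists s => //; split=> [|x y xI fx].
    have [->|sn0] := eqVneq s 0%R; first by rewrite f0.
    by apply: cost_fin => //; rewrite lt_neqAle eq_sym sn0; case/andP: sI.
  by have := smax x xI; rewrite /u fx.
have [e e0 he] := cost_right_gt cf (lexx 0%R)
  (ltac:(by rewrite f0 ltry) : (`|tau| * b - u a)%:E < f 0%R).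
pose c := (Num.min e a / 2)%R.
have m0 : (0 < Num.min e a)%R by rewrite lt_min e0.
have [m1 m2] : (Num.min e a <= e /\ Num.min e a <= a)%R.
  by rewrite !ge_min !lexx orbT.
have c0 : (0 < c)%R by rewrite /c; lra.
have [||s sI smax] := cun c.
- by rewrite (ltW c0) /= /c; lra.
- by apply: cvg_at_right_filter; apply: cu.
have s0 : (0 < s)%R by case/andP: sI => cs _; apply: lt_le_trans cs.
exists s; first by case/andP: sI => _ ->; rewrite ltW.
split=> [|x y /andP[x0 xb] fx]; first exact: cost_fin.
have [cx|xc] := leP c x.
  by have := smax x ltac:(by rewrite cx); rewrite /u fx.
have xp : (0 < x)%R.
  by rewrite lt_neqAle x0 andbT; apply/eqP => x00; move: f0; rewrite x00 fx.
have := he x ltac:(by rewrite xp /=; move: xc; rewrite /c; lra).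
rewrite add0r fx lte_fin => lo.
have := smax a ltac:(by rewrite /c; apply/andP; split; lra).
rewrite /u in lo *.
have xt : (x * tau <= b * `|tau|)%R.
  apply: (@le_trans _ _ (x * `|tau|)%R); first by rewrite ler_wpM2l // ler_norm.
  by rewrite ler_wpM2r.
lra.
Qed.

(** Once the objective fails to increase from a to b, concavity forbids larger
    values beyond b. *)
Lemma maximiser_exists f tau (a b : R) : cost f -> (0 < a < b)%R ->
  (b * tau - fine (f b) <= a * tau - fine (f a))%R ->
  exists s, maximiser f tau s.
Proof.
move=> cf ab le; have [s /andP[s0 sb] [fs smax]] := maximiser_exists_on tau cf ab.
case/andP: ab => a0 ab; have b0 : (0 < b)%R by lra.
have fa := cost_fin cf a0; have fb := cost_fin cf b0.
exists s; apply: (maximiserI cf s0 (esym (fineK fs))) => x y x0 fx.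
have [xb|bx] := leP x b; first by apply: smax; rewrite ?x0.
apply: le_trans (smax b _ ltac:(by rewrite ltW //=) (esym (fineK fb))).
pose k := ((x - b) / (x - a))%R.
have xa : (0 < x - a)%R by lra.
have kE : (k * (x - a) = x - b)%R by rewrite /k divfK // gt_eqF.
have k01 : (0 < k < 1)%R.
  by apply/andP; split; [rewrite divr_gt0 // subr_gt0|rewrite ltr_pdivrMr //; lra].
have fa' : f a <= (fine (f a))%:E by rewrite fineK.
have fx' : f x <= y%:E by rewrite fx.
have := cost_convex cf (ltW a0) x0 k01 fa' fx'.
have -> : (k * a + (1 - k) * x = b)%R by move: kE; lra.
rewrite -(fineK fb) lee_fin => cv.
have bE : (b * tau = k * (a * tau) + (1 - k) * (x * tau))%R.
  have -> : b = (k * a + (1 - k) * x)%R by move: kE; lra.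
  by ring.
case/andP: k01 => k0 k1; nra.
Qed.

Lemma increasing_objective_le f tau (S : nat) x y : cost f ->
  (forall n, (n.+1%:R * tau - fine (f n.+1%:R) <
              n.+2%:R * tau - fine (f n.+2%:R))%R) ->
  (0 <= x <= S.+1%:R)%R -> f x <= y%:E ->
  (x * tau - y <= S.+1%:R * tau - fine (f S.+1%:R))%R.
Proof.
move=> cf inc /andP[x0 xS] fx.
have f1 : f S.+1%:R <= (fine (f S.+1%:R))%:E by rewrite fineK // cost_fin.
have fn2 := cost_fin cf (ltr0Sn R S.+1).
have f2 : f S.+2%:R <= (fine (f S.+2%:R))%:E by rewrite fineK.
move: xS; rewrite le_eqVlt => /orP[/eqP xS|xS].
  by move: fx; rewrite xS -(fineK (cost_fin cf (ltr0Sn R S))) lee_fin; lra.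
rewrite leNgt; apply/negP => lt.
have := inc S.
set b := (S.+1%:R : R) in xS f1 lt *; set c := (S.+2%:R : R) in f2 fn2 *.
have cb : c = (b + 1)%R by rewrite /c /b -natr1.
move=> incS.
have cx : (0 < c - x)%R by lra.
pose k := ((c - b) / (c - x))%R.
have kE : (k * (c - x) = c - b)%R by rewrite /k divfK // gt_eqF.
have k01 : (0 < k < 1)%R.
  by apply/andP; split; [rewrite divr_gt0 // cb; lra|rewrite ltr_pdivrMr //; lra].
have c0 : (0 <= c)%R by rewrite /c.
have := cost_convex cf x0 c0 k01 fx f2.
have -> : (k * x + (1 - k) * c = b)%R by move: kE; lra.
have fb : f b \is a fin_num by apply: cost_fin; rewrite // /b.
rewrite -(fineK fb) lee_fin => cv.
have bE : (b * tau = k * (x * tau) + (1 - k) * (c * tau))%R.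
  have -> : b = (k * x + (1 - k) * c)%R by move: kE; lra.
  by ring.
case/andP: k01 => k0 k1; nra.
Qed.

End DualityOneVariable.

(** * Integrals that may be undefined or nonmeasurable *)

Section WidelyDefinedIntegral.
Set Implicit Arguments.
Unset Strict Implicit.
Context {d : measure_display} {T : measurableType d} {R : realType}.
Variable mu : {sigma_finite_measure set T -> \bar R}.
Implicit Types (f g : T -> \bar R) (l : T -> R).

Lemma measurable_fun_mem (D : set T) : measurable D ->
  measurable_fun setT (fun x => x \in D).
Proof.
move=> mD; apply: (measurable_fun_bool true).
by rewrite setTI [X in measurable X](_ : _ = D) //;
  apply/seteqP; split => x /=; [exact: set_mem|exact: mem_set].
Qed.

(** The integral of a nonnegative function is the supremum of the integrals of
    the simple functions below it, hence monotone without measurability. This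
    is what makes the Bregman integrand, which involves derivatives of beta(r,
    .), accessible without a study of its measurability. *)
Lemma ge0_le_integral_nonmeasurable f g : (forall x, 0 <= f x) ->
  (forall x, f x <= g x) -> \int[mu]_x f x <= \int[mu]_x g x.
Proof.
move=> f0 fg; have g0 x : 0 <= g x by apply: le_trans (f0 x) (fg x).
rewrite (ge0_integralTE mu f0) (ge0_integralTE mu g0).
apply: le_ereal_sup => _ [h /= hf <-]; exists h => // x.
exact: le_trans (hf x) (fg x).
Qed.

Lemma ae_ge0_le_integral_nonmeasurable f g : (forall x, 0 <= f x) ->
  measurable_fun setT g -> (forall x, 0 <= g x) ->
  {ae mu, forall x, f x <= g x} -> \int[mu]_x f x <= \int[mu]_x g x.
Proof.
move=> f0 mg g0 [N [mN muN sN]].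
pose g' x := if x \in N then +oo else g x.
have mg' : measurable_fun setT g'.
  by apply: measurable_fun_ifT => //; exact: measurable_fun_mem.
have -> : \int[mu]_x g x = \int[mu]_x g' x.
  apply: ae_eq_integral => //; exists N; split=> // x /= xN.
  apply: contrapT => nx; apply: xN => _; rewrite /g' ifF //.
  by apply/negbTE/negP => /set_mem.
apply: ge0_le_integral_nonmeasurable => // x; rewrite /g'.
case: ifPn => [_|xN]; first exact: leey.
apply/negPn/negP => nle; move/negP: xN; apply; apply/mem_set; apply: sN; exact/negP.
Qed.

Lemma EFin_Rintegral l : mu.-integrable setT (EFin \o l) ->
  (\int[mu]_x l x)%R%:E = \int[mu]_x (l x)%:E.
Proof. by move=> il; rewrite /Rintegral fineK // integrable_fin_num. Qed.

Lemma integral_le_Rintegral f l : mu.-integrable setT (EFin \o l) ->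
  {ae mu, forall x, (0 <= l x)%R} ->
  {ae mu, forall x, f x <= (l x)%:E} -> \int[mu]_x f x <= (\int[mu]_x l x)%R%:E.
Proof.
move=> il l0 fl; rewrite integralE.
have fp0 x : 0 <= f^\+ x by exact: funepos_ge0.
apply: (@le_trans _ _ (\int[mu]_x f^\+ x)).
  by rewrite geeDl // oppe_le0 integral_ge0.
have ml : measurable_fun setT (EFin \o l) by exact: measurable_int il.
rewrite EFin_Rintegral //.
have -> : \int[mu]_x (l x)%:E = \int[mu]_x (EFin \o l)^\+ x.
  apply: ae_eq_integral => //; first exact: measurable_funepos.
  apply: filterS l0 => x l0 _; rewrite !funeposE /=.
  by rewrite max_l // lee_fin.
apply: ae_ge0_le_integral_nonmeasurable => //; first exact: measurable_funepos.
by apply: filterS fl => x fx; rewrite !funeposE /=; apply: le_max2.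
Qed.

Lemma wint_lty f : wint mu f < +oo -> \int[mu]_x f^\+ x < +oo.
Proof.
rewrite /wint /integral_defined; case: ifPn => // nd lt.
rewrite ltey; apply/eqP => fp; move: nd lt; rewrite fp eqxx /= => nn.
rewrite integralE fp; move: nn.
by case: (\int[mu]_x f^\- x).
Qed.

Lemma integrable_wint f : mu.-integrable setT f -> wint mu f = \int[mu]_x f x.
Proof.
move=> fi; rewrite /wint /integral_defined.
have := integral_funepos_lt_pinfty measurableT fi.
by rewrite ltey => /negbTE ->.
Qed.

Lemma wint_integrable f : measurable_fun setT f -> wint mu f \is a fin_num ->
  mu.-integrable setT f.
Proof.
move=> mf ff; have fp : \int[mu]_x f^\+ x < +oo.
  by apply: wint_lty; rewrite ltey_eq ff.
have fn : \int[mu]_x f^\- x < +oo.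
  rewrite ltey; apply/eqP => fn; move: ff.
  rewrite /wint /integral_defined fn eqxx andbT.
  case: ifPn => // _; rewrite integralE fn.
  by move: fp; case: (\int[mu]_x f^\+ x).
apply/integrableP; split=> //.
have -> : \int[mu]_x `|f x| = \int[mu]_x (f^\+ x + f^\- x).
  by apply: eq_integral => x _; rewrite -[LHS]/((abse \o f) x) fune_abse.
rewrite ge0_integralD //; first exact: lte_add_pinfty.
- exact: measurable_funepos.
- exact: measurable_funeneg.
Qed.

(** An integrable majorant makes the positive part integrable, which excludes
    the undefined case. *)
Lemma wint_le f l : measurable_fun setT f -> mu.-integrable setT (EFin \o l) ->
  {ae mu, forall x, f x <= (l x)%:E} -> wint mu f <= (\int[mu]_x l x)%R%:E.
Proof.
move=> mf il fl; have ml : measurable_fun setT (EFin \o l) by exact: measurable_int il.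
have lp := integral_funepos_lt_pinfty measurableT il.
have fp : \int[mu]_x f^\+ x <= \int[mu]_x (EFin \o l)^\+ x.
  apply: ae_ge0_le_integral => //; [exact: measurable_funepos..|].
  by apply: filterS fl => x fx _; rewrite !funeposE /=; apply: le_max2.
have fn : \int[mu]_x (EFin \o l)^\- x <= \int[mu]_x f^\- x.
  apply: ae_ge0_le_integral => //; [exact: measurable_funeneg..|].
  by apply: filterS fl => x fx _; rewrite !funenegE; apply: le_max2 => //; rewrite leeN2.
rewrite /wint /integral_defined.
have := le_lt_trans fp lp; rewrite ltey => /negbTE -> /=.
by rewrite EFin_Rintegral // integralE [leRHS]integralE leeB.
Qed.

(** In the undefined case [wint] is +oo, on the right side of the
    inequality. *)
Lemma wint_ge f l : measurable_fun setT f -> mu.-integrable setT (EFin \o l) ->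
  {ae mu, forall x, (l x)%:E <= f x} -> (\int[mu]_x l x)%R%:E <= wint mu f.
Proof.
move=> mf il fl; have ml : measurable_fun setT (EFin \o l) by exact: measurable_int il.
have fp : \int[mu]_x (EFin \o l)^\+ x <= \int[mu]_x f^\+ x.
  apply: ae_ge0_le_integral => //; [exact: measurable_funepos..|].
  by apply: filterS fl => x fx _; rewrite !funeposE /=; apply: le_max2.
have fn : \int[mu]_x f^\- x <= \int[mu]_x (EFin \o l)^\- x.
  apply: ae_ge0_le_integral => //; [exact: measurable_funeneg..|].
  by apply: filterS fl => x fx _; rewrite !funenegE; apply: le_max2 => //; rewrite leeN2.
rewrite /wint; case: ifPn => _; last exact: leey.
by rewrite EFin_Rintegral // integralE [leRHS]integralE leeB.
Qed.

End WidelyDefinedIntegral.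

(** * Measurability of normal integrands *)

Section NormalIntegrand.
Set Implicit Arguments.
Unset Strict Implicit.
Context {d : measure_display} {Omega : measurableType d} {R : realType}.
Variable beta : Omega -> R -> \bar R.
Hypothesis hbeta : integrand beta.

Lemma integrand_cost r : cost (beta r).
Proof.
case: hbeta => _ h1 h2 h3 h4 h5 h6; split.
- exact: h1.
- exact: h2.
- exact: h3.
- exact: h4.
- exact: h5.
- exact: h6.
Qed.

(** Grid points strictly above x: beta(r, .) is right continuous on all of [0,
    +oo), so the approximation from above also works where p vanishes. *)
Definition grid (n : nat) (x : R) : R := ((Num.truncn (x * n.+1%:R)).+1%:R / n.+1%:R)%R.

Lemma grid_itv n (x : R) : (0 <= x)%R -> (x < grid n x <= x + n.+1%:R^-1)%R.
Proof.
move=> x0; have n0 : (0 < n.+1%:R :> R)%R by [].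
have xn0 : (0 <= x * n.+1%:R)%R by rewrite mulr_ge0.
rewrite /grid; have /andP[lo up] := truncn_itv xn0.
rewrite ltr_pdivlMr // up /= ler_pdivrMr // mulrDl mulVf ?gt_eqF //.
by rewrite -natr1 lerD2r.
Qed.

Lemma grid_cvg (x : R) : (0 <= x)%R -> grid n x @[n --> \oo] --> x^'+.
Proof.
move=> x0 A /nbhs_right0P[e /= e0 he].
have [N _ hN] := near_infty_natSinv_lt (PosNum e0).
exists N => //= n /hN /= ne; have /andP[g1 g2] := grid_itv n x0.
have := he (grid n x - x)%R; rewrite [(x + _)%R]addrC subrK; apply; rewrite ?subr_gt0 //.
rewrite /= sub0r normrN gtr0_norm ?subr_gt0 //.
by rewrite ltrBlDl (le_lt_trans g2) // ltrD2l.
Qed.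

Lemma measurable_integrand_comp (p : Omega -> R) : measurable_fun setT p ->
  (forall r, 0 <= p r)%R -> measurable_fun setT (fun r => beta r (p r)).
Proof.
move=> mp p0.
apply: (emeasurable_fun_cvg (fun n r => beta r (grid n (p r)))) => [n|r _].
  move=> _ Y mY; rewrite setTI.
  rewrite [X in measurable X](_ : _ = \bigcup_j
    ((fun r => p r * n.+1%:R)%R @^-1` `[j%:R, j.+1%:R[%classic `&`
     (beta ^~ (j.+1%:R / n.+1%:R)%R) @^-1` Y)); last first.
    apply/seteqP; split=> [r /= Yr|r [j _] /= []].
      exists (Num.truncn (p r * n.+1%:R)) => //; split=> //=.
      by rewrite in_itv /=; apply: truncn_itv; rewrite mulr_ge0.
    rewrite in_itv /= => jr; rewrite /grid.
    suff -> : Num.truncn (p r * n.+1%:R) = j by [].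
    exact/truncn_def.
  apply: bigcup_measurable => j _; apply: measurableI.
    rewrite -[X in measurable X]setTI.
    by apply: measurable_funM => //; exact: measurable_itv.
  by rewrite -[X in measurable X]setTI; apply: (integrand_meas hbeta).
apply: cvg_comp (cost_right_cvg (integrand_cost r) (p0 r)).
exact: grid_cvg.
Qed.

Lemma measurable_conjugate (tau : Omega -> R) : measurable_fun setT tau ->
  measurable_fun setT (fun r => conjugate (beta r) (tau r)).
Proof.
move=> mtau.
pose h n r : \bar R := (positive_rational n * tau r)%:E - beta r (positive_rational n).
have -> : (fun r => conjugate (beta r) (tau r)) = (fun r => esups (h ^~ r) 0%N).
  apply/funext => r; apply/eqP; rewrite eq_le; apply/andP; split.
    apply: conjugate_le_rational => [|n]; first exact: integrand_cost.
    by apply: ereal_sup_ubound; exists n.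
  apply: ge_ereal_sup => _ [n _ <-]; exact: conjugate_ge.
apply: measurable_fun_esups => n; apply: emeasurable_funB.
  by apply/measurable_EFinP; apply: measurable_funM.
exact: (integrand_meas hbeta).
Qed.

End NormalIntegrand.

(** * Exhaustion, patching and monotone convergence *)

Section Exhaustion.
Set Implicit Arguments.
Unset Strict Implicit.
Context {d : measure_display} {T : measurableType d} {R : realType}.
Variable mu : {sigma_finite_measure set T -> \bar R}.

(** Intersect the increasing unions of a sigma-finite cover with the sublevel
    sets of b. *)
Lemma sigma_finite_exhaustion (b : T -> R) : measurable_fun setT b ->
  exists D : nat -> set T,
    [/\ forall n, measurable (D n), forall n, mu (D n) < +oo,
        {homo D : m n / (m <= n)%N >-> m `<=` n},
        forall x, exists n, D n x & forall n x, D n x -> (b x <= n%:R)%R].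
Proof.
move=> mb; have [F FT mF] := sigma_finiteT mu.
exists (fun n => (\big[setU/set0]_(i < n) F i) `&` [set x | (b x <= n%:R)%R]).
have mbn n : measurable [set x | (b x <= n%:R)%R].
  rewrite -[X in measurable X]setTI.
  have -> : [set x | (b x <= n%:R)%R] = b @^-1` `]-oo, n%:R]%classic.
    by apply/seteqP; split=> x /=; rewrite in_itv.
  exact: mb.
have mU n : measurable (\big[setU/set0]_(i < n) F i).
  by apply: bigsetU_measurable => i _; case: (mF i).
split.
- by move=> n; apply: measurableI.
- move=> n; apply: (@le_lt_trans _ _ (mu (\big[setU/set0]_(i < n) F i))).
    by apply: le_measure; rewrite ?inE //; apply: measurableI.
  apply: (@le_lt_trans _ _ (\sum_(i < n) mu (F i))).
    have := @Boole_inequality _ _ _ mu F n; apply => i; by case: (mF i).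
  by apply/lte_sum_pinfty => i _; case: (mF i).
- move=> m n mn x [Fx /= bx]; split.
    exact: (subset_bigsetU mn).
  by apply: le_trans bx _; rewrite ler_nat.
- move=> x; have [i _ Fx] : (\bigcup_i F i) x by rewrite -FT.
  have b0 : (0 <= `|b x|)%R by [].
  exists (maxn i.+1 (Num.truncn `|b x|).+1); split.
    apply: (subset_bigsetU (leq_maxl _ _)).
    by rewrite big_ord_recr /=; right.
  have /andP[_ bt] := truncn_itv b0.
  apply: le_trans (ler_norm _) _; apply: (le_trans (ltW bt)).
  by rewrite ler_nat leq_maxr.
- by move=> n x [].
Qed.

Lemma integrable_lin (f g : T -> R) (a b : R) :
  mu.-integrable setT (EFin \o f) -> mu.-integrable setT (EFin \o g) ->
  mu.-integrable setT (EFin \o (fun x => a * f x + b * g x)%R).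
Proof.
move=> fi gi; have := integrableD measurableT
  (integrableZl measurableT a fi) (integrableZl measurableT b gi).
by apply: eq_integrable.
Qed.

Lemma Rintegral_lin (f g : T -> R) (a b : R) :
  mu.-integrable setT (EFin \o f) -> mu.-integrable setT (EFin \o g) ->
  (\int[mu]_x (a * f x + b * g x) = a * \int[mu]_x f x + b * \int[mu]_x g x)%R.
Proof.
move=> fi gi; rewrite RintegralD ?RintegralZl //.
- by have := integrableZl measurableT a fi; apply: eq_integrable.
- by have := integrableZl measurableT b gi; apply: eq_integrable.
Qed.

Lemma integrable_patch (D : set T) (s f : T -> R) (c : R) : measurable D ->
  mu D < +oo -> measurable_fun setT s -> mu.-integrable setT (EFin \o f) ->
  (forall x, D x -> `|s x| <= c)%R ->
  mu.-integrable setT (EFin \o (fun x => if x \in D then s x else f x)).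
Proof.
move=> mD Dfin ms fi sc.
have mf : measurable_fun setT f by apply/measurable_EFinP; exact: measurable_int fi.
have Di : mu.-integrable setT (EFin \o (\1_D : T -> R)).
  apply/integrableP; split; first exact/measurable_EFinP.
  under eq_integral do rewrite gee0_abs ?lee_fin //.
  by rewrite integral_indic // setIT.
have ni : mu.-integrable setT (EFin \o (fun x => `|f x|)%R) by exact: integrable_norm.
apply: le_integrable (integrable_lin `|c| 1 Di ni) => //.
  apply/measurable_EFinP; apply: measurable_fun_ifT => //.
  exact: measurable_fun_mem.
move=> x _ /=; rewrite lee_fin indicE.
have nn : (0 <= `|f x|)%R by [].
case: ifPn => [/set_mem Dx|_] /=.
  rewrite mulr1 mul1r [leRHS]ger0_norm ?addr_ge0 //.
  by apply: (le_trans (sc x Dx)); rewrite -[leLHS]addr0 lerD // ler_norm.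
by rewrite mulr0 add0r mul1r normr_id.
Qed.

(** The function h is the pointwise limit of the f n. *)
Lemma monotone_integral_le (f : nat -> T -> R) (c : R) :
  (forall n, measurable_fun setT (f n)) -> (forall n x, 0 <= f n x)%R ->
  (forall x, {homo f ^~ x : m n / (m <= n)%N >-> (m <= n)%R}) ->
  (forall n, \int[mu]_x (f n x)%:E <= c%:E) ->
  exists h : T -> \bar R, [/\ measurable_fun setT h, forall x, 0 <= h x,
    \int[mu]_x h x <= c%:E & forall n x, (f n x)%:E <= h x].
Proof.
move=> mf f0 nd fc; pose g n x := (f n x)%:E.
have mg n : measurable_fun setT (g n) by exact/measurable_EFinP.
have g0 n x : setT x -> 0 <= g n x by move=> _; rewrite lee_fin.
have ndg x : setT x -> {homo g ^~ x : m n / (m <= n)%N >-> m <= n}.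
  by move=> _ m n mn; rewrite lee_fin nd.
have cvx x : cvgn (g ^~ x) by apply: ereal_nondecreasing_is_cvgn; apply: ndg.
exists (fun x => limn (g ^~ x)); split.
- by apply: (emeasurable_fun_cvg g) => // x _; apply: cvx.
- by move=> x; apply: lime_ge => //; near=> n; exact: g0.
- rewrite monotone_convergence //; apply: lime_le.
    apply: ereal_nondecreasing_is_cvgn => m n mn.
    by apply: ge0_le_integral => // x _; [exact: g0|exact: ndg].
  by near=> n; exact: fc.
- by move=> n x; apply: lime_ge => //; near=> m; apply: ndg => //; near: m; exists n.
Unshelve. all: by end_near. Qed.

End Exhaustion.

(** * Budgets and the interchange of infimum and integral *)

Section Budgets.
Set Implicit Arguments.
Unset Strict Implicit.
Context {d : measure_display} {Omega : measurableType d} {R : realType}.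
Variable mu : {sigma_finite_measure set Omega -> \bar R}.
Variables (beta : Omega -> R -> \bar R) (X : Omega -> R).
Hypothesis hbeta : integrand beta.
Hypothesis mX : measurable_fun [set: Omega] X.
Implicit Types (p g s : Omega -> R).

(** A real integrable majorant g of r |-> beta(r, p r) is carried along with p.
    The pairs (p, g) form a convex set on which mass, moment and cost are
    linear and finite. The functional H itself could take the value -oo on
    functions that are not densities. *)
Record budget p g : Prop := {
  budget_ge0 : forall r, (0 <= p r)%R ;
  budget_int : mu.-integrable setT (EFin \o p) ;
  budget_Xint : mu.-integrable setT (EFin \o (fun r => X r * p r)%R) ;
  budget_gint : mu.-integrable setT (EFin \o g) ;
  budget_le : {ae mu, forall r, beta r (p r) <= (g r)%:E} }.

Definition total p : R := (\int[mu]_r p r)%R.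
Definition first_moment p : R := (\int[mu]_r (X r * p r))%R.

Lemma budget_mix p1 g1 p2 g2 (a : R) : (0 < a < 1)%R ->
  budget p1 g1 -> budget p2 g2 ->
  let p r := (a * p1 r + (1 - a) * p2 r)%R in
  let g r := (a * g1 r + (1 - a) * g2 r)%R in
  [/\ budget p g, total p = (a * total p1 + (1 - a) * total p2)%R,
    first_moment p = (a * first_moment p1 + (1 - a) * first_moment p2)%R &
    total g = (a * total g1 + (1 - a) * total g2)%R].
Proof.
move=> /andP[a0 a1] b1 b2 p g.
have [p10 p1i x1i g1i l1] := b1; have [p20 p2i x2i g2i l2] := b2.
have Xp : (fun r => X r * p r)%R =
    (fun r => a * (X r * p1 r) + (1 - a) * (X r * p2 r))%R.
  by apply/funext => r; rewrite /p; ring.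
split.
- split.
  + by move=> r; have := p10 r; have := p20 r; rewrite /p; nra.
  + exact: integrable_lin.
  + by rewrite Xp; apply: integrable_lin.
  + exact: integrable_lin.
  + apply: filterS2 l1 l2 => r l1 l2.
    by apply: cost_convex => //; [exact: integrand_cost|rewrite a0].
- by rewrite /total Rintegral_lin.
- by rewrite /first_moment Xp Rintegral_lin.
- by rewrite /total Rintegral_lin.
Qed.

(** Its integral over a budget is the quantity bounded from below in a Lagrange
    multiplier rule. *)
Definition lagrangian (lam nu : R) p g : Omega -> R :=
  fun r => (X r * p r + lam * g r - nu * p r)%R.

Lemma lagrangian_integral lam nu p g : budget p g ->
  mu.-integrable setT (EFin \o lagrangian lam nu p g) /\
  total (lagrangian lam nu p g) =
    (first_moment p + lam * total g - nu * total p)%R.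
Proof.
move=> [p0 pi xi gi l].
have E : lagrangian lam nu p g =
    (fun r => 1 * (X r * p r) + 1 * (lam * g r + (- nu) * p r))%R.
  by apply/funext => r; rewrite /lagrangian; ring.
have i2 := integrable_lin lam (- nu) gi pi.
rewrite E; split; first exact: integrable_lin.
by rewrite /total !Rintegral_lin //; rewrite /first_moment; ring.
Qed.

Lemma measurable_lagrangian lam nu p g : measurable_fun setT p ->
  measurable_fun setT g -> measurable_fun setT (lagrangian lam nu p g).
Proof.
move=> mp mg; apply: measurable_funB; last exact: measurable_funM.
by apply: measurable_funD; apply: measurable_funM.
Qed.

Section Replacement.
Variables p0 g0 : Omega -> R.
Hypothesis b0 : budget p0 g0.

(** Local modifications: any admissible p may replace p0 on a set where
    everything is bounded. Such modifications suffice to recover pointwise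
    information from inequalities between integrals. *)
Lemma budget_patch p g (D : set Omega) (c : R) : measurable D -> mu D < +oo ->
  measurable_fun setT p -> measurable_fun setT g -> (forall r, 0 <= p r)%R ->
  {ae mu, forall r, beta r (p r) <= (g r)%:E} ->
  (forall r, D r -> (`|X r| + `|p r| + `|g r| <= c)%R) ->
  budget (fun r => if r \in D then p r else p0 r)
         (fun r => if r \in D then g r else g0 r).
Proof.
move=> mD Dfin mp mg p1 le bd; have [q0 qi xi gi l0] := b0.
have nx r : (0 <= `|X r|)%R by [].
have np r : (0 <= `|p r|)%R by [].
have ng r : (0 <= `|g r|)%R by [].
split.
- by move=> r; case: ifP.
- apply: (integrable_patch (c := c)) => // r /bd.
  by have := nx r; have := ng r; lra.
- rewrite (_ : (fun r => _)%R = (fun r => if r \in D then X r * p r else X r * p0 r)%R); last first.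
    by apply/funext => r; case: ifP.
  apply: (integrable_patch (c := c * c)) => //; first exact: measurable_funM.
  move=> r /bd; rewrite normrM => bdr.
  have := nx r; have := np r; have := ng r; nra.
- apply: (integrable_patch (c := c)) => // r /bd.
  by have := nx r; have := np r; lra.
- by apply: filterS2 le l0 => r h1 h2; case: ifP.
Qed.

Section LowerBound.
Variables lam nu c : R.
Hypothesis hc : forall p g, budget p g ->
  (c <= first_moment p + lam * total g - nu * total p)%R.

Let L0 := lagrangian lam nu p0 g0.
Let C : R := (total L0 - c)%R.

(** Patching (p, g) into (p0, g0) on D n lowers the Lagrangian by the integral
    of the gain over D n, and the result is again a budget, so that integral is
    at most C. Now let D n exhaust the space. *)
Lemma gain_integral_le p g : measurable_fun setT p -> measurable_fun setT g ->
  (forall r, 0 <= p r)%R -> {ae mu, forall r, beta r (p r) <= (g r)%:E} ->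
  (forall r, lagrangian lam nu p g r <= L0 r)%R ->
  \int[mu]_r (L0 r - lagrangian lam nu p g r)%:E <= C%:E.
Proof.
move=> mp mg p1 le gain.
have mb : measurable_fun setT (fun r => `|X r| + `|p r| + `|g r|)%R.
  by apply: measurable_funD; [apply: measurable_funD|]; apply: measurableT_comp.
have [D [mD Dfin Dnd Dcov Dbd]] := sigma_finite_exhaustion mu mb.
pose e r : R := (L0 r - lagrangian lam nu p g r)%R.
have e0 r : (0 <= e r)%R by rewrite /e subr_ge0.
have [L0i L0E] := lagrangian_integral lam nu b0.
have mL0 : measurable_fun setT L0 by apply/measurable_EFinP; exact: measurable_int L0i.
have mL : measurable_fun setT (lagrangian lam nu p g).
  exact: measurable_lagrangian.
have me : measurable_fun setT e by apply: measurable_funB.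
pose f n r : R := if r \in D n then e r else 0%R.
have [||||h [mh h0 hint fh]] := @monotone_integral_le _ _ _ mu f C.
- move=> n; apply: measurable_fun_ifT => //; exact: measurable_fun_mem.
- by move=> n r; rewrite /f; case: ifP.
- move=> r m n mn; rewrite /f; case: ifPn => [/set_mem Dm|_]; last by case: ifP.
  by rewrite mem_set //; apply: Dnd Dm.
- move=> n.
  have bp := budget_patch (mD n) (Dfin n) mp mg p1 le (Dbd n).
  have [Li LE] := lagrangian_integral lam nu bp.
  (* The gain on D n is the difference of the Lagrangians before and after
     patching. *)
  have fE : f n = (fun r => 1 * L0 r + (-1) * lagrangian lam nu
       (fun r => if r \in D n then p r else p0 r)
       (fun r => if r \in D n then g r else g0 r) r)%R.
    apply/funext => r; rewrite /f /e /L0 /lagrangian; case: ifP => _; ring.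
  have fi : mu.-integrable setT (EFin \o f n) by rewrite fE; apply: integrable_lin.
  rewrite -(EFin_Rintegral fi) lee_fin fE Rintegral_lin //.
  rewrite -/(total _) -[X in (_ + -1 * X <= _)%R]/(total _) LE /C.
  have := hc bp; lra.
apply: le_trans hint; apply: ge0_le_integral => //.
- by move=> r _; rewrite lee_fin e0.
- exact/measurable_EFinP.
- move=> r _; have [n Dn] := Dcov r.
  by apply: le_trans (fh n r); rewrite /f mem_set.
Qed.

Let cand n : (Omega -> R) * (Omega -> R) :=
  (fun=> positive_rational n, fun r => fine (beta r (positive_rational n))).

(** A measurable selection of almost optimal values: go through the constant
    functions with positive rational values, and at each r keep the new value
    whenever it lowers the Lagrangian. *)
Fixpoint greedy n : (Omega -> R) * (Omega -> R) :=
  if n is n'.+1 then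
    let better r := (lagrangian lam nu (cand n').1 (cand n').2 r <
      lagrangian lam nu (greedy n').1 (greedy n').2 r)%R in
    (fun r => if better r then (cand n').1 r else (greedy n').1 r,
     fun r => if better r then (cand n').2 r else (greedy n').2 r)
  else (p0, g0).

Let Lg n := lagrangian lam nu (greedy n).1 (greedy n).2.

Lemma greedy_step n r :
  Lg n.+1 r = Num.min (lagrangian lam nu (cand n).1 (cand n).2 r) (Lg n r).
Proof.
by rewrite /Lg /= /lagrangian /=; case: ltP.
Qed.

Lemma greedy_admissible n : [/\ measurable_fun setT (greedy n).1,
  measurable_fun setT (greedy n).2, forall r, (0 <= (greedy n).1 r)%R &
  {ae mu, forall r, beta r ((greedy n).1 r) <= ((greedy n).2 r)%:E}].
Proof.
elim: n => [|n [m1 m2 h0 hl]] /=.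
  have [q0 qi xi gi l0] := b0; split=> //.
    by apply/measurable_EFinP; exact: measurable_int qi.
  by apply/measurable_EFinP; exact: measurable_int gi.
have mc : measurable_fun setT (fun r => fine (beta r (positive_rational n))).
  by apply: measurableT_comp => //; apply: (integrand_meas hbeta).
have ml : measurable_fun setT (fun r =>
    lagrangian lam nu (cand n).1 (cand n).2 r < Lg n r)%R.
  apply: measurable_fun_ltr; apply: measurable_lagrangian => //.
  exact: measurable_cst.
split.
- exact: measurable_fun_ifT.
- exact: measurable_fun_ifT.
- by move=> r; case: ifP => // _; rewrite ltW // positive_rational_gt0.
- apply: filterS hl => r hl; case: ifP => // _.
  have fb : beta r (positive_rational n) \is a fin_num.
    by apply: (integrand_fin hbeta); exact: positive_rational_gt0.
  by rewrite /= fineK.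
Qed.

(** Interchange of infimum and integral: a lower bound for the integrals of the
    Lagrangian over all budgets bounds the integral of its pointwise infimum.
    The greedy selections decrease the Lagrangian to that infimum, and T is the
    limit of their gains over (p0, g0). *)
Lemma interchange : exists T : Omega -> \bar R,
  [/\ measurable_fun setT T, forall r, 0 <= T r, \int[mu]_r T r <= C%:E &
    (forall n r, (L0 r - (X r * positive_rational n +
       lam * fine (beta r (positive_rational n)) -
       nu * positive_rational n))%:E <= T r)].
Proof.
pose f n r : R := (L0 r - Lg n r)%R.
have dec n r : (Lg n.+1 r <= Lg n r)%R by rewrite greedy_step ge_min lexx orbT.
have nd r : {homo f ^~ r : m n / (m <= n)%N >-> (m <= n)%R}.
  by apply/nondecreasing_seqP => n; rewrite /f lerD2l lerN2.
have le0 n r : (Lg n r <= L0 r)%R.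
  by have := nd r 0%N n (leq0n n); rewrite /f subrr subr_ge0.
have [||||T [mT T0 Tint fT]] := @monotone_integral_le _ _ _ mu f C.
- move=> n; have [m1 m2 h0 hl] := greedy_admissible n.
  have [m01 m02 _ _] := greedy_admissible 0.
  by apply: measurable_funB; apply: measurable_lagrangian.
- by move=> n r; rewrite subr_ge0.
- by [].
- move=> n; have [m1 m2 h0 hl] := greedy_admissible n.
  exact: (gain_integral_le m1 m2 h0 hl (le0 n)).
exists T; split=> // n r; apply: le_trans (fT n.+1 r).
rewrite lee_fin /f lerD2l lerN2 greedy_step.
by rewrite ge_min; apply/orP; left; rewrite /lagrangian /=.
Qed.

End LowerBound.
End Replacement.
End Budgets.

(** * The dual function *)

Section DualFunction.
Set Implicit Arguments.
Unset Strict Implicit.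
Context {d : measure_display} {Omega : measurableType d} {R : realType}.
Variable mu : {sigma_finite_measure set Omega -> \bar R}.
Variables (beta : Omega -> R -> \bar R) (X : Omega -> R).
Hypothesis hbeta : integrand beta.
Hypothesis mX : measurable_fun [set: Omega] X.
Implicit Types (p g : Omega -> R).

Lemma measurable_tilt (t1 t2 : R) :
  measurable_fun setT (fun r => t1 + t2 * X r)%R.
Proof. by apply: measurable_funD => //; apply: measurable_funM. Qed.

Let conj t1 t2 r := conjugate (beta r) (t1 + t2 * X r)%R.

Lemma measurable_conj t1 t2 : measurable_fun setT (conj t1 t2).
Proof. by apply: measurable_conjugate => //; exact: measurable_tilt. Qed.

(** Integrate the inequality p tau - beta(p) <= conj(tau). *)
Lemma weak_duality p g t1 t2 : budget mu beta X p g ->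
  (t1 * total mu p + t2 * first_moment mu X p - total mu g)%:E <= K mu beta X t1 t2.
Proof.
move=> [p0 pi xi gi l].
have i1 := integrable_lin t1 t2 pi xi.
have i2 := integrable_lin 1 (-1) i1 gi.
have -> : (t1 * total mu p + t2 * first_moment mu X p - total mu g =
   \int[mu]_r (1 * (t1 * p r + t2 * (X r * p r)) + (-1) * g r))%R.
  by rewrite !Rintegral_lin //; rewrite mul1r mulN1r.
apply: wint_ge => //; first exact: measurable_conj.
apply: filterS l => r l; apply: le_trans (conjugate_ge_fin _ l).
by rewrite lee_fin; lra.
Qed.

Lemma K_fin_integrable t1 t2 : K mu beta X t1 t2 \is a fin_num ->
  [/\ mu.-integrable setT (conj t1 t2),
    mu.-integrable setT (EFin \o (fun r => fine (conj t1 t2 r))),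
    {ae mu, forall r, conj t1 t2 r \is a fin_num} &
    (\int[mu]_r fine (conj t1 t2 r))%R = fine (K mu beta X t1 t2)].
Proof.
move=> Kf; have mc := measurable_conj t1 t2.
have ci := wint_integrable mc Kf.
have cf : {ae mu, forall r, conj t1 t2 r \is a fin_num}.
  by apply: filterS (integrable_ae measurableT ci) => r; apply.
have mfc : measurable_fun setT (EFin \o (fun r => fine (conj t1 t2 r))).
  by apply/measurable_EFinP; apply: measurableT_comp.
have fci : mu.-integrable setT (EFin \o (fun r => fine (conj t1 t2 r))).
  apply: le_integrable ci => // r _ /=.
  by case: (conj t1 t2 r) => [x| |] //=; rewrite ?normr0 ?leey.
split=> //; apply: EFin_inj; rewrite EFin_Rintegral // fineK //.
rewrite /K integrable_wint //; apply: ae_eq_integral => //.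
by apply: filterS cf => r cf _ /=; rewrite fineK.
Qed.

Section StrongDuality.
Variables p0 g0 : Omega -> R.
Hypothesis b0 : budget mu beta X p0 g0.
Variables lam nu c : R.
Hypothesis hc : forall p g, budget mu beta X p g ->
  (c <= first_moment mu X p + lam * total mu g - nu * total mu p)%R.

Let L0 := lagrangian X lam nu p0 g0.

Lemma real_gain_bound : exists T : Omega -> R,
  [/\ mu.-integrable setT (EFin \o T), (total mu T <= total mu L0 - c)%R &
    {ae mu, forall r, forall n, (L0 r - (X r * positive_rational n +
       lam * fine (beta r (positive_rational n)) -
       nu * positive_rational n) <= T r)%R}].
Proof.
have [T [mT T0 Tint hT]] := interchange hbeta mX b0 hc.
have Ti : mu.-integrable setT T.
  apply/integrableP; split=> //.
  under eq_integral do rewrite gee0_abs //.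
  by apply: le_lt_trans Tint _; rewrite ltry.
have mfT : measurable_fun setT (EFin \o (fine \o T)).
  by apply/measurable_EFinP; apply: measurableT_comp.
have fTi : mu.-integrable setT (EFin \o (fine \o T)).
  apply: le_integrable Ti => // r _ /=.
  by case: (T r) => [x| |] //=; rewrite ?normr0 ?leey.
exists (fine \o T); split=> //.
  rewrite -lee_fin EFin_Rintegral //; apply: le_trans Tint.
  apply: ge0_le_integral => // r _ /=; first by rewrite lee_fin fine_ge0.
  by move: (T0 r); case: (T r) => [x| |] //= _; rewrite leey.
apply: filterS (integrable_ae measurableT Ti) => r /(_ I) Tf n.
by rewrite -lee_fin /= fineK //; exact: hT.
Qed.

(** Dividing the Lagrangian by -lam turns its pointwise infimum into the
    conjugate at (nu - X) / lam, whose integral is K at (nu / lam, -1 /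
    lam). *)
Lemma strong_duality : (0 < lam)%R ->
  K mu beta X (nu / lam)%R (- lam^-1)%R <= (- c / lam)%:E.
Proof.
move=> lam0; have [T [Ti Tle hT]] := real_gain_bound.
have [L0i _] := lagrangian_integral lam nu b0.
have ln0 : (lam != 0)%R by rewrite gt_eqF.
have li := integrable_lin lam^-1 (- lam^-1) Ti L0i.
apply: le_trans (wint_le _ li _) _.
- exact: measurable_conj.
- apply: filterS hT => r hT; apply: conjugate_le_rational => [|n].
    exact: integrand_cost.
  have fb : beta r (positive_rational n) \is a fin_num.
    by apply: (integrand_fin hbeta); exact: positive_rational_gt0.
  rewrite -(fineK fb) -EFinB lee_fin; have := hT n.
  set s := positive_rational n; set y := fine _ => hTn.
  have -> : (s * (nu / lam + - lam^-1 * X r) - y =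
     lam^-1 * (- (X r * s + lam * y - nu * s)))%R by field.
  have -> : (lam^-1 * T r + - lam^-1 * lagrangian X lam nu p0 g0 r =
     lam^-1 * (T r - L0 r))%R by rewrite /L0; ring.
  by rewrite ler_pM2l ?invr_gt0 //; move: hTn; rewrite /L0; lra.
rewrite lee_fin Rintegral_lin // -/(total mu T) -/(total mu (lagrangian _ _ _ _ _)).
have -> : (lam^-1 * total mu T + - lam^-1 * total mu (lagrangian X lam nu p0 g0)
  = (total mu T - total mu L0) / lam)%R by rewrite /L0; ring.
by rewrite ler_pM2r ?invr_gt0 //; move: Tle; lra.
Qed.

(** Without a cost term the Lagrangian is (X - nu) s. Large s force X >=
    nu almost everywhere; small s bring it arbitrarily close to 0, hence c
    <= 0. *)
Lemma degenerate_multiplier : lam = 0%R -> nu%:E <= m mu X /\ (c <= 0)%R.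
Proof.
move=> lam0; have [T [Ti Tle hT]] := real_gain_bound.
have [L0i _] := lagrangian_integral lam nu b0.
split.
  apply/ess_infP; apply: filterS hT => r hT; rewrite /= lee_fin leNgt.
  apply/negP => Xnu.
  (* Any value beyond M gains more than T r allows. *)
  pose M := ((`|T r - L0 r| + 1) / (nu - X r))%R.
  have d0 : (0 < nu - X r)%R by lra.
  have M0 : (0 <= M)%R by apply: divr_ge0; [exact: addr_ge0|exact: ltW].
  have [n /andP[Mn _]] := @positive_rational_dense R M (M + 1)%R ltac:(by rewrite M0; lra).
  have := hT n; rewrite lam0 mul0r addr0.
  have : (`|T r - L0 r| + 1 < positive_rational n * (nu - X r))%R.
    by move: Mn; rewrite /M ltr_pdivrMr.
  by have := ler_norm (T r - L0 r); lra.
suff : (total mu L0 <= total mu T)%R by move: Tle; lra.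
have mL0 : measurable_fun setT (EFin \o L0) by exact: measurable_int L0i.
rewrite -lee_fin [leLHS]EFin_Rintegral // -(integrable_wint L0i).
apply: wint_le => //; apply: filterS hT => r hT.
rewrite lee_fin leNgt; apply/negP => lt.
(* Any value below e gains more than T r allows. *)
pose e := ((L0 r - T r) / (`|X r - nu| + 1))%R.
have n0 : (0 <= `|X r - nu|)%R by [].
have e0 : (0 < e)%R by rewrite divr_gt0 ?subr_gt0 // ltr_wpDl.
have [n /andP[s0 se]] := @positive_rational_dense R 0%R e ltac:(by rewrite lexx).
have := hT n; rewrite lam0 mul0r addr0.
have : (positive_rational n * (`|X r - nu| + 1) < L0 r - T r)%R.
  by move: se; rewrite /e ltr_pdivlMr // ltr_wpDl.
have := ler_norm (X r - nu)%R; nra.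
Qed.
End StrongDuality.

End DualFunction.

(** * Minimisers of the dual function *)

Section DualMinimiser.
Set Implicit Arguments.
Unset Strict Implicit.
Context {d : measure_display} {Omega : measurableType d} {R : realType}.
Variable mu : {sigma_finite_measure set Omega -> \bar R}.
Variables (beta : Omega -> R -> \bar R) (X : Omega -> R).
Hypothesis hbeta : integrand beta.
Hypothesis mX : measurable_fun [set: Omega] X.
Variables t1 t2 : R.
Hypothesis Kfin : K mu beta X t1 t2 \is a fin_num.

Let tau r : R := (t1 + t2 * X r)%R.
Let u n r : R := (n.+1%:R * tau r - fine (beta r n.+1%:R))%R.

(** When the objective at tau keeps increasing, all the points that nearly
    reach the supremum lie beyond S + 1, so lowering tau by e costs the
    conjugate at least (S + 1) e. *)
Lemma conjugate_shift_le (S : nat) r (e : R) : (0 < e)%R ->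
  conjugate (beta r) (tau r) \is a fin_num ->
  (forall n, u n r < u n.+1 r)%R ->
  (u S r + S.+1%:R * e <= fine (conjugate (beta r) (tau r)))%R ->
  conjugate (beta r) (tau r - e)%R <=
    conjugate (beta r) (tau r) - (S.+1%:R * e)%:E.
Proof.
move=> e0 cf inc gap; have cr := integrand_cost hbeta r.
apply: conjugate_le => // [|s y s0 fs].
  by rewrite -(fineK cf) -EFinB ltNyr.
have fs' : beta r s <= y%:E by rewrite fs.
rewrite -(fineK cf) -EFinB lee_fin.
have [sS|Ss] := leP s S.+1%:R.
  have := increasing_objective_le cr inc (ltac:(by rewrite s0) : (0 <= s <= S.+1%:R)%R) fs'.
  move: gap; rewrite /u; nra.
have : (s * tau r - y <= fine (conjugate (beta r) (tau r)))%R.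
  by rewrite -lee_fin fineK //; apply: conjugate_ge_fin.
nra.
Qed.

Lemma conjugate_mono f (a b : R) : cost f -> (a <= b)%R ->
  conjugate f a <= conjugate f b.
Proof.
move=> cf ab; apply: conjugate_le => // [|s y s0 fs].
  exact: conjugate_gtNy.
have fs' : f s <= y%:E by rewrite fs.
by apply: le_trans (conjugate_ge_fin b fs'); rewrite lee_fin; nra.
Qed.

Variables p0 g0 : Omega -> R.
Hypothesis b0 : budget mu beta X p0 g0.
Hypothesis tmin : forall e : R, (0 < e)%R ->
  K mu beta X t1 t2 <= K mu beta X (t1 - e)%R t2 + e%:E.

Let conj r := conjugate (beta r) (tau r).

Let unattained : set Omega :=
  [set r | conj r \is a fin_num /\ forall n, (u n r < u n.+1 r)%R].

Lemma measurable_u n : measurable_fun setT (u n).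
Proof.
apply: measurable_funB.
  by apply: measurable_funM => //; apply: measurable_tilt.
by apply: measurableT_comp => //; apply: (integrand_meas hbeta).
Qed.

Lemma measurable_unattained : measurable unattained.
Proof.
have -> : unattained =
    (fun r => conj r \is a fin_num) @^-1` [set true] `&`
    \bigcap_n ((fun r => u n r < u n.+1 r)%R @^-1` [set true]).
  apply/seteqP; split=> r [h1 h2]; split=> // n; [move=> _|]; exact: h2.
apply: measurableI.
  rewrite (_ : _ @^-1` _ = setT `&` [set r | conj r \is a fin_num]).
    by apply: emeasurable_fin_num => //; exact: measurable_conj.
  by rewrite setTI; apply/seteqP; split.
apply: bigcap_measurable => // n _; rewrite -[X in measurable X]setTI.
by apply: measurable_fun_ltr => //; exact: measurable_u.
Qed.

(** On the set where no maximiser exists the conjugate has infinite left slope.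
    Lowering t1 by e lowers K by at most e, since t1 minimises K - t1; but on
    the part A j of that set it lowers the conjugate by at least (S + 1) e with
    e = 1 / (j + 1). Hence (S + 1) mu(A j) <= 1, and the A j increase to the
    set. *)
Lemma unattained_bound (S : nat) : mu unattained <= (S.+1%:R^-1)%:E.
Proof.
pose A j := unattained `&`
  [set r | (u S r + S.+1%:R * j.+1%:R^-1 <= fine (conj r))%R].
have mA j : measurable (A j).
  apply: measurableI; first exact: measurable_unattained.
  rewrite -[X in measurable X]setTI; apply: measurable_fun_le => //.
    by apply: measurable_funD => //; exact: measurable_u.
  by apply: measurableT_comp => //; exact: measurable_conj.
have muA j : mu (A j) <= (S.+1%:R^-1)%:E.
  have e0 : (0 < j.+1%:R^-1 :> R)%R by rewrite invr_gt0.
  set e := (j.+1%:R^-1 : R)%R in e0.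
  have [ci fci cf cE] := K_fin_integrable hbeta mX Kfin.
  have monoK r : conjugate (beta r) ((t1 - e) + t2 * X r)%R <= conj r.
    by apply: conjugate_mono; [exact: integrand_cost|rewrite /tau; lra].
  have Ke : K mu beta X (t1 - e)%R t2 \is a fin_num.
    rewrite fin_real //; apply/andP; split.
      apply: lt_le_trans (weak_duality _ _ (t1 - e)%R t2 b0) => //.
      by rewrite ltNyr.
    apply: le_lt_trans (wint_le _ fci _) _; last by rewrite ltry.
      exact: measurable_conj.
    by apply: filterS cf => r cf; have {}cf : conj r \is a fin_num by [];
      rewrite /= fineK //; exact: monoK.
  have [ci' fci' cf' cE'] := K_fin_integrable hbeta mX Ke.
  have Sj0 : (0 < S.+1%:R * e)%R by rewrite mulr_gt0.
  have : \int[mu]_r ((S.+1%:R * e) * \1_(A j) r)%:E <=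
    (\int[mu]_r (1 * fine (conj r) +
       (-1) * fine (conjugate (beta r) ((t1 - e) + t2 * X r)%R)))%R%:E.
    apply: integral_le_Rintegral.
    - exact: integrable_lin.
    - apply: filterS2 cf cf' => r cf cf'; have {}cf : conj r \is a fin_num by [].
      by have := monoK r; rewrite -(fineK cf) -(fineK cf') lee_fin; lra.
    - apply: filterS2 cf cf' => r cf cf'; have {}cf : conj r \is a fin_num by [].
      rewrite lee_fin indicE; case: (boolP (r \in A j)) => [/set_mem[[_ inc] gap]|_].
        have := conjugate_shift_le e0 cf inc gap.
        have -> : (tau r - e = (t1 - e) + t2 * X r)%R by rewrite /tau; ring.
        have -> : conjugate (beta r) (tau r) = (fine (conj r))%:E by rewrite fineK.
        by rewrite -(fineK cf') -EFinB lee_fin /=; lra.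
      have := monoK r; rewrite -(fineK cf) -(fineK cf') lee_fin /=; lra.
  rewrite Rintegral_lin // cE cE'.
  have := tmin e0; rewrite -(fineK Kfin) -(fineK Ke) -EFinD lee_fin => tm.
  have -> : \int[mu]_r ((S.+1%:R * e) * \1_(A j) r)%:E =
      (S.+1%:R * e)%:E * mu (A j).
    under eq_integral do rewrite EFinM.
    rewrite ge0_integralZl_EFin //; first by rewrite integral_indic // setIT.
    - exact/measurable_EFinP.
    - exact: ltW.
  move=> h; have : (S.+1%:R * e)%:E * mu (A j) <= e%:E.
    by apply: le_trans h _; rewrite lee_fin; lra.
  move=> h'; rewrite -(@lee_pmul2l _ (S.+1%:R * e)%:E) ?lte_fin //.
  by apply: le_trans h' _; rewrite -EFinM lee_fin mulrAC mulfV // mul1r.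
have -> : mu unattained = mu (\bigcup_j A j).
  congr (mu _); apply/seteqP; split=> [r ur|r [j _ []] //].
  have [cr inc] := ur.
  have gap : (0 < fine (conj r) - u S r)%R.
    rewrite subr_gt0; apply: (lt_le_trans (inc S)).
    rewrite -lee_fin fineK //; apply: conjugate_ge_fin.
    by rewrite fineK // (integrand_fin hbeta).
  have gap' : (0 < (fine (conj r) - u S r) / S.+1%:R)%R by rewrite divr_gt0.
  have [N _ hN] := near_infty_natSinv_lt (PosNum gap').
  have : (N.+1%:R^-1 < (fine (conj r) - u S r) / S.+1%:R)%R by apply: (hN N) => /=.
  rewrite ltr_pdivlMr // => lt.
  by exists N => //; split=> //=; rewrite -lerBrDl mulrC ltW.
have Acvg : (mu \o A) j @[j --> \oo] --> mu (\bigcup_j A j).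
  apply: nondecreasing_cvg_mu => //; first exact: bigcup_measurable.
  move=> i j ij; apply/subsetPset => r [ur /= h]; split=> //=.
  apply: le_trans h; rewrite lerD2l ler_wpM2l // lef_pV2 ?posrE // ler_nat.
  by rewrite ltnS.
rewrite -(cvg_lim _ Acvg) //; apply: lime_le.
  by apply/cvg_ex; eexists; exact: Acvg.
by near=> j; exact: muA.
Unshelve. all: by end_near. Qed.

(** The bound holds for all S, so its set is null. For almost every r off it
    the objective stops increasing, and [maximiser_exists] applies. *)
Lemma ae_maximiser : {ae mu, forall r, exists s, maximiser (beta r) (tau r) s}.
Proof.
have [ci fci cf cE] := K_fin_integrable hbeta mX Kfin.
have mu0 : mu unattained = 0.
  apply/eqP; rewrite eq_le measure_ge0 andbT.
  apply/lee_addgt0Pr => e e0; rewrite add0e.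
  have [N _ hN] := near_infty_natSinv_lt (PosNum e0).
  apply: le_trans (unattained_bound N) _.
  by rewrite lee_fin ltW //; apply: (hN N) => /=.
have nu : {ae mu, forall r, ~ unattained r}.
  exists unattained; split=> //; first exact: measurable_unattained.
  by move=> r /= /contrapT.
apply: filterS2 cf nu => r cf nr; have {}cf : conj r \is a fin_num by [].
have [n hn] : exists n, ~ (u n r < u n.+1 r)%R.
  by apply/existsNP => inc; apply: nr.
move/negP: hn; rewrite -leNgt => hn.
apply: (maximiser_exists (integrand_cost hbeta r) _ hn).
by rewrite ltr0n ltr_nat /= ltnS.
Qed.

(** Integrate [Delta_le], with the integrable cost bound g in place of beta(r,
    p r). *)
Lemma Bregman_le p g : budget mu beta X p g ->
  B mu beta p (p_ beta X t1 t2) <=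
  (total mu g + fine (K mu beta X t1 t2) - t1 * total mu p
    - t2 * first_moment mu X p)%:E.
Proof.
move=> [p1 pi xi gi l]; have [ci fci cf cE] := K_fin_integrable hbeta mX Kfin.
have i1 := integrable_lin (- t1) (- t2) pi xi.
have i2 := integrable_lin 1 1 gi fci.
have i3 := integrable_lin 1 1 i1 i2.
have -> : (total mu g + fine (K mu beta X t1 t2) - t1 * total mu p
    - t2 * first_moment mu X p = \int[mu]_r (1 * (- t1 * p r + - t2 * (X r * p r))
     + 1 * (1 * g r + 1 * fine (conj r))))%R.
  rewrite !Rintegral_lin // cE /total /first_moment; ring.
apply: integral_le_Rintegral => //.
  apply: filterS2 l cf => r l cf; have {}cf : conj r \is a fin_num by [].
  have : (p r * tau r - g r)%:E <= conj r by exact: conjugate_ge_fin.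
  by rewrite -(fineK cf) lee_fin /tau; lra.
apply: filterS2 l ae_maximiser => r l [s ms].
have cr := integrand_cost hbeta r.
rewrite /p_ (conjugate_deriv cr ms).
apply: le_trans (Delta_le cr ms (p1 r) l) _.
by rewrite lee_fin /conj /tau; lra.
Qed.

End DualMinimiser.

(** * Lagrange multipliers *)

Section Separation.
Set Implicit Arguments.
Unset Strict Implicit.
Context {R : realType}.

(** For x1 < 0 < x2 convexity places a point of C above 0, so the slopes from
    (0, v) to points on the left are at most the slopes to points on the right;
    nu is the supremum of the former. *)
Lemma supporting_line (C : R -> R -> Prop) (v : R) :
  (forall x1 y1 x2 y2 a : R, (0 < a < 1)%R -> C x1 y1 -> C x2 y2 ->
     C (a * x1 + (1 - a) * x2)%R (a * y1 + (1 - a) * y2)%R) ->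
  (exists x y : R, (x < 0)%R /\ C x y) -> (exists x y : R, (0 < x)%R /\ C x y) ->
  (forall y, C 0%R y -> (v <= y)%R) ->
  exists nu : R, forall x y, C x y -> (v + nu * x <= y)%R.
Proof.
move=> convC [xl [yl [xl0 Cl]]] [xr [yr [xr0 Cr]]] Cv.
have slopes x1 y1 x2 y2 : (x1 < 0)%R -> C x1 y1 -> (0 < x2)%R -> C x2 y2 ->
    ((v - y1) / (- x1) <= (y2 - v) / x2)%R.
  move=> x10 C1 x20 C2; have x1p : (0 < - x1)%R by lra.
  rewrite ler_pdivrMr // mulrAC ler_pdivlMr //.
  have dp : (0 < x2 - x1)%R by lra.
  pose a := (x2 / (x2 - x1))%R.
  have aE : (a * (x2 - x1) = x2)%R by rewrite /a divfK // gt_eqF.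
  have a01 : (0 < a < 1)%R.
    by rewrite /a divr_gt0 //= ltr_pdivrMr // mul1r; lra.
  have := convC _ _ _ _ _ a01 C1 C2.
  have -> : (a * x1 + (1 - a) * x2 = 0)%R by lra.
  move=> /Cv; case/andP: a01 => a0 a1 vle.
  have : (v * (x2 - x1) <= (a * y1 + (1 - a) * y2) * (x2 - x1))%R.
    by rewrite ler_pM2r.
  have -> : ((a * y1 + (1 - a) * y2) * (x2 - x1) =
     (a * (x2 - x1)) * y1 + (x2 - x1 - a * (x2 - x1)) * y2)%R by ring.
  rewrite aE; lra.
pose S := [set z : R | exists x y, [/\ (x < 0)%R, C x y & z = ((v - y) / (- x))%R]].
have S0 : S !=set0 by exists ((v - yl) / (- xl))%R, xl, yl.
have Sub x2 y2 : (0 < x2)%R -> C x2 y2 -> ubound S ((y2 - v) / x2)%R.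
  by move=> x20 C2 _ [x1 [y1 [x10 C1 ->]]]; apply: slopes.
have Shub : has_sup S by split=> //; exists ((yr - v) / xr)%R; exact: Sub.
exists (sup S) => x y Cxy.
have [x0|x0|x0] := ltgtP x 0%R.
- have : ((v - y) / (- x) <= sup S)%R by apply: ub_le_sup; [case: Shub|exists x, y].
  rewrite ler_pdivrMr; last by lra.
  lra.
- have : (sup S <= (y - v) / x)%R by apply: ge_sup => //; exact: Sub.
  by rewrite ler_pdivlMr //; lra.
- by rewrite x0 mulr0 addr0; apply: Cv; rewrite -x0.
Qed.

End Separation.

Section Multipliers.
Set Implicit Arguments.
Unset Strict Implicit.
Context {d : measure_display} {Omega : measurableType d} {R : realType}.
Variable mu : {sigma_finite_measure set Omega -> \bar R}.
Variables (beta : Omega -> R -> \bar R) (X : Omega -> R).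
Hypothesis hbeta : integrand beta.
Hypothesis mX : measurable_fun [set: Omega] X.
Implicit Types (p g : Omega -> R).

Section Masses.
Variables p0 g0 : Omega -> R.
Hypothesis b0 : budget mu beta X p0 g0.
Hypothesis p0_total : total mu p0 = 1%R.

(** Replacing p0 by k p0 on a set where everything is bounded. The set is taken
    large enough to carry some mass e of p0. *)
Lemma rescaled_budget (k : R) : (0 < k)%R ->
  exists p g (e : R), [/\ budget mu beta X p g, (0 < e)%R &
    total mu p = (1 + (k - 1) * e)%R].
Proof.
move=> k0; have [q0 qi xi gi l0] := b0.
have mp0 : measurable_fun setT p0 by apply/measurable_EFinP; exact: measurable_int qi.
pose p r := (k * p0 r)%R; pose g r := fine (beta r (p r)).
have mp : measurable_fun setT p by apply: measurable_funM.
have p1 r : (0 <= p r)%R by rewrite mulr_ge0 // ltW.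
have mg : measurable_fun setT g.
  by apply: measurableT_comp => //; apply: measurable_integrand_comp.
have le : {ae mu, forall r, beta r (p r) <= (g r)%:E}.
  apply: filterS l0 => r l; rewrite /g fineK //.
  have [pr0|pr0] := eqVneq (p0 r) 0%R.
    rewrite fin_real // (integrand_ninfty hbeta) /=.
    by apply: le_lt_trans (ltry (g0 r)); rewrite /p pr0 mulr0 -[in beta r 0%R]pr0.
  by apply: (integrand_fin hbeta); rewrite mulr_gt0 // lt_neqAle eq_sym pr0 q0.
have mb : measurable_fun setT (fun r => `|X r| + `|p r| + `|g r|)%R.
  by apply: measurable_funD; [apply: measurable_funD|]; apply: measurableT_comp.
have [D [mD Dfin Dnd Dcov Dbd]] := sigma_finite_exhaustion mu mb.
pose f n r : R := if r \in D n then p0 r else 0%R.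
have fi n : mu.-integrable setT (EFin \o f n).
  apply: le_integrable qi => //.
    apply/measurable_EFinP; apply: measurable_fun_ifT => //.
    exact: measurable_fun_mem.
  by move=> r _ /=; rewrite /f lee_fin; case: ifP => // _; rewrite normr0.
have [n fn] : exists n, (0 < total mu (f n))%R.
  apply/not_existsP => fle.
  have [||||h [mh h0 hint fh]] := @monotone_integral_le _ _ _ mu f 0%R.
  - move=> n; apply: measurable_fun_ifT => //; exact: measurable_fun_mem.
  - by move=> n r; rewrite /f; case: ifP.
  - move=> r i j ij; rewrite /f; case: ifPn => [/set_mem Di|_]; last by case: ifP.
    by rewrite mem_set //; apply: Dnd Di.
  - move=> n; rewrite -(EFin_Rintegral (fi n)) lee_fin leNgt.
    by apply/negP; exact: fle.
  have : \int[mu]_r (p0 r)%:E <= 0.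
    apply: le_trans hint; apply: ge0_le_integral => //.
    - by move=> r _; rewrite lee_fin.
    - exact/measurable_EFinP.
    - move=> r _; have [n Dn] := Dcov r.
      by apply: le_trans (fh n r); rewrite /f mem_set.
  by rewrite -(EFin_Rintegral qi) -/(total mu p0) p0_total lee_fin ler10.
exists (fun r => if r \in D n then p r else p0 r),
  (fun r => if r \in D n then g r else g0 r), (total mu (f n)); split=> //.
  exact: (budget_patch mX b0 (mD n) (Dfin n) mp mg p1 le (Dbd n)).
rewrite [in LHS](_ : (fun r => _) = (fun r => 1 * p0 r + (k - 1) * f n r)%R); last first.
  by apply/funext => r; rewrite /f /p; case: ifP => _; ring.
by rewrite /total Rintegral_lin // -/(total mu p0) p0_total !mul1r.
Qed.

(** [supporting_line] in the variable total mass minus 1. Points on both sides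
    of 0 come from [rescaled_budget]. *)
Lemma mass_multiplier (lam w : R) :
  (forall p g, budget mu beta X p g -> total mu p = 1%R ->
     (w <= first_moment mu X p + lam * total mu g)%R) ->
  exists nu : R, forall p g, budget mu beta X p g ->
    (w - nu <= first_moment mu X p + lam * total mu g - nu * total mu p)%R.
Proof.
move=> hw.
pose C x y := exists p g, [/\ budget mu beta X p g, x = (total mu p - 1)%R &
  y = (first_moment mu X p + lam * total mu g)%R].
have [||||nu hnu] := @supporting_line _ C w.
- move=> _ _ _ _ a a01 [p1 [g1 [b1 -> ->]]] [p2 [g2 [b2 -> ->]]].
  have [b E1 E2 E3] := budget_mix hbeta a01 b1 b2.
  by eexists; eexists; split; [exact: b|rewrite E1; ring|rewrite E2 E3; ring].
- have [p [g [e [b e0 E]]]] := @rescaled_budget (1/2)%R ltac:(lra).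
  exists (total mu p - 1)%R, (first_moment mu X p + lam * total mu g)%R.
  by split; [rewrite E; lra|exists p, g].
- have [p [g [e [b e0 E]]]] := @rescaled_budget 2%R ltac:(lra).
  exists (total mu p - 1)%R, (first_moment mu X p + lam * total mu g)%R.
  by split; [rewrite E; lra|exists p, g].
- move=> _ [p [g [b E ->]]]; apply: hw => //; lra.
exists nu => p g b.
have := hnu _ _ (ex_intro _ p (ex_intro _ g (And3 b erefl erefl))).
lra.
Qed.

(** [supporting_line] in the variable cost minus k, among densities. The
    default density costs 0 < k, which gives a point on the left; adding
    multiples of p0 to g0 wastes cost, which gives points on the right and
    forces the sign of the multiplier. *)
Lemma cost_multiplier (k v : R) : (0 < k)%R -> total mu g0 = 0%R ->
  (v <= first_moment mu X p0)%R ->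
  (forall p g, budget mu beta X p g -> total mu p = 1%R -> total mu g = k ->
     (v <= first_moment mu X p)%R) ->
  exists2 lam : R, (0 <= lam)%R & forall p g, budget mu beta X p g ->
    total mu p = 1%R -> (v + lam * k <= first_moment mu X p + lam * total mu g)%R.
Proof.
move=> k0 g00 vb hv; have [q0 qi xi gi l0] := b0.
have slack t : (0 <= t)%R -> budget mu beta X p0 (fun r => 1 * g0 r + t * p0 r)%R.
  move=> t0; split=> //; first exact: integrable_lin.
  apply: filterS l0 => r l; apply: le_trans l _; rewrite lee_fin.
  by have := q0 r; nra.
have slackE t : total mu (fun r => 1 * g0 r + t * p0 r)%R = t.
  rewrite /total Rintegral_lin // -/(total mu g0) -/(total mu p0) g00 p0_total.
  by rewrite mulr0 add0r mulr1.
pose C x y := exists p g, [/\ budget mu beta X p g, total mu p = 1%R,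
  x = (total mu g - k)%R & y = first_moment mu X p].
have Cp0 t : (0 <= t)%R -> C (t - k)%R (first_moment mu X p0).
  by move=> t0; exists p0; eexists; split; [exact: (slack t t0)| |rewrite slackE|].
have [||||nu hnu] := @supporting_line _ C v.
- move=> _ _ _ _ a a01 [p1 [g1 [b1 o1 -> ->]]] [p2 [g2 [b2 o2 -> ->]]].
  have [b E1 E2 E3] := budget_mix hbeta a01 b1 b2.
  eexists; eexists; split; [exact: b| |rewrite E3; ring|rewrite E2; ring].
  by rewrite E1 o1 o2; ring.
- by exists (0 - k)%R; eexists; split; [|exact: (Cp0 0%R)]; lra.
- by exists (k + 1 - k)%R; eexists; split; [|apply: (Cp0 (k + 1)%R)]; lra.
- move=> _ [p [g [b o E ->]]]; apply: (hv p g) => //; lra.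
exists (- nu)%R.
  rewrite oppr_ge0 leNgt; apply/negP => nu0.
  (* With waste t a line of positive slope would pass above the moment of
     p0. *)
  pose t := ((first_moment mu X p0 - v) / nu + k + 1)%R.
  have t0 : (0 <= t)%R.
    have : (0 <= (first_moment mu X p0 - v) / nu)%R.
      by apply: divr_ge0; [rewrite subr_ge0|exact: ltW].
    rewrite /t; lra.
  have := hnu _ _ (Cp0 t t0).
  have -> : (nu * (t - k) = (first_moment mu X p0 - v) + nu)%R.
    by rewrite /t; field; rewrite gt_eqF.
  lra.
move=> p g b o.
have := hnu _ _ (ex_intro _ p (ex_intro _ g (And4 b o erefl erefl))).
lra.
Qed.

End Masses.
End Multipliers.

(** * The primal problem *)

Section PrimalSide.
Set Implicit Arguments.
Unset Strict Implicit.
Context {d : measure_display} {Omega : measurableType d} {R : realType}.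
Variable mu : {sigma_finite_measure set Omega -> \bar R}.
Variables (beta : Omega -> R -> \bar R) (X p0 : Omega -> R).
Hypothesis hst : standing mu beta X p0.
Implicit Types (p g : Omega -> R).

Let hbeta : integrand beta := standing_integrand hst.
Let mX : measurable_fun [set: Omega] X := standing_X hst.

Lemma H_ge0 p : density mu p -> 0 <= H mu beta p.
Proof. by move=> dp; rewrite -(standing_H0 hst); apply: (standing_H_min hst). Qed.

Lemma H_fin_num p : density mu p -> H mu beta p < +oo -> H mu beta p \is a fin_num.
Proof.
move=> dp hp; rewrite fin_real // hp andbT.
by apply: lt_le_trans (H_ge0 dp); rewrite ltNyr.
Qed.

Lemma integrable_density p : density mu p -> mu.-integrable setT (EFin \o p).
Proof.
move=> [mp p1 pint]; apply/integrableP; split; first exact/measurable_EFinP.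
by under eq_integral do rewrite gee0_abs ?lee_fin //; rewrite pint ltry.
Qed.

Lemma total_density p : density mu p -> total mu p = 1%R.
Proof.
move=> dp; apply: EFin_inj.
by rewrite EFin_Rintegral ?(density_int dp) //; exact: integrable_density.
Qed.

Definition cost_density p r : R := fine (beta r (p r)).

Lemma cost_densityP p : density mu p -> H mu beta p \is a fin_num ->
  [/\ mu.-integrable setT (EFin \o cost_density p),
    {ae mu, forall r, beta r (p r) = (cost_density p r)%:E} &
    (total mu (cost_density p))%:E = H mu beta p].
Proof.
move=> dp Hf; have [mp p1 _] := dp.
have mb : measurable_fun setT (fun r => beta r (p r)).
  exact: measurable_integrand_comp.
have bi := wint_integrable mb Hf.
have bf : {ae mu, forall r, beta r (p r) = (cost_density p r)%:E}.
  by apply: filterS (integrable_ae measurableT bi) => r /(_ I) h; rewrite fineK.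
have mc : measurable_fun setT (EFin \o cost_density p).
  by apply/measurable_EFinP; apply: measurableT_comp.
have ci : mu.-integrable setT (EFin \o cost_density p).
  apply: le_integrable bi => // r _ /=; rewrite /cost_density.
  by case: (beta r (p r)) => [x| |] //=; rewrite ?normr0 ?leey.
split=> //; rewrite /total EFin_Rintegral // /H integrable_wint //.
by apply: ae_eq_integral => //; apply: filterS bf => r -> _.
Qed.

Lemma density_budget p : density mu p -> H mu beta p \is a fin_num ->
  mean mu X p \is a fin_num ->
  [/\ budget mu beta X p (cost_density p),
    (total mu (cost_density p))%:E = H mu beta p &
    (first_moment mu X p)%:E = mean mu X p].
Proof.
move=> dp Hf mf; have [ci cb cE] := cost_densityP dp Hf.
have [mp p1 _] := dp.
have xi : mu.-integrable setT (EFin \o (fun r => X r * p r)%R).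
  by apply: wint_integrable => //; apply/measurable_EFinP; apply: measurable_funM.
split=> //.
  split=> //; first exact: integrable_density.
  by apply: filterS cb => r ->.
by rewrite /first_moment EFin_Rintegral // /mean (integrable_wint xi).
Qed.

Lemma budget_density p g : budget mu beta X p g -> total mu p = 1%R ->
  [/\ density mu p, H mu beta p <= (total mu g)%:E &
    mean mu X p = (first_moment mu X p)%:E].
Proof.
move=> [p1 pi xi gi l] o.
have mp : measurable_fun setT p by apply/measurable_EFinP; exact: measurable_int pi.
split.
- by split=> //; rewrite -(EFin_Rintegral pi) -/(total mu p) o.
- by apply: wint_le => //; exact: measurable_integrand_comp.
- by rewrite /mean (integrable_wint xi) /first_moment EFin_Rintegral.
Qed.

Lemma default_mean_fin : mean mu X p0 \is a fin_num.
Proof.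
have /andP[lo up] := standing_b0 hst; rewrite fin_real //.
by rewrite (le_lt_trans _ lo) ?leNye //= (lt_le_trans up) ?leey.
Qed.

Let g0 := cost_density p0.
Let b0 : R := first_moment mu X p0.

Lemma default_budget : [/\ budget mu beta X p0 g0, total mu p0 = 1%R,
  total mu g0 = 0%R & m mu X < b0%:E].
Proof.
have dp := standing_density hst.
have Hf : H mu beta p0 \is a fin_num by rewrite (standing_H0 hst).
have [b cE xE] := density_budget dp Hf default_mean_fin.
split=> //; first exact: total_density.
  by apply: EFin_inj; rewrite cE (standing_H0 hst).
by rewrite /b0 xE; case/andP: (standing_b0 hst).
Qed.

(** Solving the Fenchel-Young inequality for X p gives an integrable minorant,
    because t2 < 0. *)
Lemma mean_gtNy p t1 t2 : (t2 < 0)%R -> K mu beta X t1 t2 \is a fin_num ->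
  density mu p -> H mu beta p \is a fin_num -> -oo < mean mu X p.
Proof.
move=> t20 Kf dp Hf; have [ci cb cE] := cost_densityP dp Hf.
have [mp p1 _] := dp.
have [ji fji jf jE] := K_fin_integrable hbeta mX Kf.
have pi := integrable_density dp.
have i1 := integrable_lin 1 1 ci fji.
have i2 := integrable_lin t2^-1 (- (t2^-1 * t1)) i1 pi.
apply: lt_le_trans (wint_ge _ i2 _); first exact: ltNyr.
  by apply/measurable_EFinP; apply: measurable_funM.
apply: filterS2 cb jf => r cb jf; rewrite lee_fin.
have cb' : beta r (p r) <= (cost_density p r)%:E by rewrite cb.
have := conjugate_ge_fin (t1 + t2 * X r)%R cb'; rewrite -(fineK jf) lee_fin.
set y := cost_density p r; set z := fine _ => yz.
have -> : (t2^-1 * (1 * y + 1 * z) + - (t2^-1 * t1) * p r =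
   (y + z - t1 * p r) / t2)%R by ring.
by rewrite ler_ndivrMr //; lra.
Qed.

(** F is convex with minimum 0 at b0: mixing a density of mean b with p0 in the
    right proportion gives mean b' at no larger cost. *)
Lemma F_nonincreasing (b b' : R) : (b <= b' <= b0)%R ->
  F mu beta X b' <= F mu beta X b.
Proof.
move=> /andP[bb' b'b0]; apply: le_ereal_inf_tmp => _ [p [dp mp] <-].
have [->|Hp] := eqVneq (H mu beta p) +oo; first exact: leey.
have Hf : H mu beta p \is a fin_num by apply: H_fin_num; rewrite // ltey.
have [bp cE xE] := density_budget dp Hf ltac:(by rewrite mp).
have [bb0 o0 g00 _] := default_budget.
have tg0 : (0 <= total mu (cost_density p))%R by rewrite -lee_fin cE H_ge0.
have xb : first_moment mu X p = b by apply: EFin_inj; rewrite xE.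
have [b'E|b'n] := eqVneq b' b; first by rewrite b'E; apply: ereal_inf_lbound; exists p.
have dbb : (0 < b0 - b)%R by rewrite subr_gt0 (lt_le_trans _ b'b0) // lt_neqAle eq_sym b'n.
have [b'E|b'n0] := eqVneq b' b0.
  apply: le_trans (H_ge0 dp); rewrite -(standing_H0 hst).
  apply: ereal_inf_lbound; exists p0 => //; split; first exact: standing_density hst.
  by have [_ _ <-] := density_budget (standing_density hst)
    ltac:(by rewrite (standing_H0 hst)) default_mean_fin; rewrite b'E.
pose a := ((b0 - b') / (b0 - b))%R.
have aE : (a * (b0 - b) = b0 - b')%R by rewrite /a divfK // gt_eqF.
have a01 : (0 < a < 1)%R.
  apply/andP; split.
    by rewrite divr_gt0 // subr_gt0 lt_neqAle b'n0.
  rewrite ltr_pdivrMr // mul1r ltrD2l ltrN2 lt_neqAle eq_sym b'n //.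
have [bm E1 E2 E3] := budget_mix hbeta a01 bp bb0.
have om : total mu (fun r => a * p r + (1 - a) * p0 r)%R = 1%R.
  by rewrite E1 o0 (total_density dp); ring.
have [dm Hm Mm] := budget_density bm om.
apply: (@le_trans _ _ (H mu beta (fun r => a * p r + (1 - a) * p0 r)%R)).
  apply: ereal_inf_lbound; eexists; last reflexivity; split=> //.
  by rewrite Mm E2 xb; congr EFin; move: aE; rewrite /b0; lra.
apply: le_trans Hm _; rewrite E3 g00 -cE lee_fin.
by case/andP: a01 => a0 a1; nra.
Qed.

(** Monotonicity guarantees that the limit defining [kmax] exists; it is
    then the supremum of F on the interval from m to b0, and bounded by k
    if F is. *)
Lemma lt_kmax_lt_F (k : R) : k%:E < kmax mu beta X ->
  exists b1 : R, [/\ m mu X < b1%:E, (b1 < b0)%R & k%:E < F mu beta X b1].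
Proof.
move=> kk; have [_ _ _ mb0] := default_budget.
apply: contrapT => none.
have Fk (b : R) : m mu X < b%:E -> (b < b0)%R -> F mu beta X b <= k%:E.
  by move=> mb bb; rewrite leNgt; apply/negP => kF; apply: none; exists b.
move: kk; rewrite ltNge; apply/negP/negPn; rewrite /kmax.
case mE : (m mu X) mb0 => [c| |] // mb0.
  have cb : (BRight c < BLeft b0)%O by rewrite bnd_simp -lte_fin.
  have nd : {in `]c, b0[%R &, {homo F mu beta X : x y / (x <= y)%R >-> y <= x}}.
    move=> x y; rewrite !in_itv /= => /andP[_ xb] /andP[_ yb] xy.
    by apply: F_nonincreasing; rewrite xy (ltW yb).
  rewrite (cvg_lim _ (nonincreasing_at_right_cvge _ cb nd)) //.
  apply: ge_ereal_sup => _ [x /= + <-]; rewrite in_itv /= => /andP[cx xb].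
  by apply: Fk => //; rewrite mE lte_fin.
(* Reflecting and truncating below b0 yields a function monotone on the whole
   line. *)
pose F' x := F mu beta X (Num.min (- x) (b0 - 1))%R.
have ndF' : {homo F' : x y / (x <= y)%R >-> x <= y}.
  move=> x y xy; apply: F_nonincreasing; apply/andP; split.
    rewrite le_min !ge_min lexx orbT andbT.
    by apply/orP; left; rewrite lerN2.
  by rewrite ge_min; apply/orP; right; lra.
have cv : F mu beta X x @[x --> -oo%R] --> ereal_sup (range F').
  rewrite cvgNy_compNP; apply: cvg_trans (nondecreasing_cvge ndF').
  apply: near_eq_cvg; near=> x; rewrite /F' /= min_l //.
  have : (1 - b0 <= x)%R by near: x; by apply: nbhs_pinfty_ge; rewrite num_real.
  lra.
rewrite (cvg_lim _ cv) //; apply: ge_ereal_sup => _ [x _ <-].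
apply: Fk; first by rewrite mE ltNyr.
by rewrite gt_min; apply/orP; right; lra.
Unshelve. all: by end_near. Qed.

End PrimalSide.

(** * The two Bregman inequalities *)

Section WorstCase.
Set Implicit Arguments.
Unset Strict Implicit.
Context {d : measure_display} {Omega : measurableType d} {R : realType}.
Variable mu : {sigma_finite_measure set Omega -> \bar R}.
Variables (beta : Omega -> R -> \bar R) (X p0 : Omega -> R).
Hypothesis hst : standing mu beta X p0.
Implicit Types (p g : Omega -> R).

Let hbeta : integrand beta := standing_integrand hst.
Let mX : measurable_fun [set: Omega] X := standing_X hst.
Let g0 := cost_density beta p0.

Lemma K_gtNy t1 t2 : -oo < K mu beta X t1 t2.
Proof.
have [bb0 _ _ _] := default_budget hst.
by apply: lt_le_trans (weak_duality hbeta mX t1 t2 bb0); rewrite ltNyr.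
Qed.

Lemma dual_objectiveE k t1 t2 z : K mu beta X t1 t2 = z%:E ->
  dual_objective mu beta X k t1 t2 = ((k + z - t1) / t2)%:E.
Proof. by rewrite /dual_objective => ->. Qed.

(** The value v of the primal problem restricted to budgets is at least b1,
    because a density of smaller mean and cost at most k could be mixed with p0
    to contradict k < F(b1). Two multipliers, first for the cost, then for the
    mass, give a lower bound for all budgets. The cost multiplier is nonzero:
    otherwise v <= nu <= m < b1. Then [strong_duality] turns the bound into a
    value of the dual objective. *)
Lemma V_dual_attained (k : R) : (0 < k)%R -> k%:E < kmax mu beta X ->
  exists v u1 u2 : R, [/\ V mu beta X k <= v%:E, (u2 < 0)%R &
    v%:E <= dual_objective mu beta X k u1 u2].
Proof.
move=> k0 kk; have [b1 [mb1 b1b0 Fb1]] := lt_kmax_lt_F hst kk.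
have [bb0 o0 g00 _] := default_budget hst.
have low p g : budget mu beta X p g -> total mu p = 1%R -> (total mu g <= k)%R ->
    (b1 <= first_moment mu X p)%R.
  move=> bp o gk; rewrite leNgt; apply/negP => xb.
  pose b0 := first_moment mu X p0.
  have dbb : (0 < b0 - first_moment mu X p)%R by rewrite /b0; lra.
  pose a := ((b0 - b1) / (b0 - first_moment mu X p))%R.
  have aE : (a * (b0 - first_moment mu X p) = b0 - b1)%R by rewrite /a divfK // gt_eqF.
  have a01 : (0 < a < 1)%R.
    apply/andP; split; first by rewrite divr_gt0 // subr_gt0.
    by rewrite ltr_pdivrMr // mul1r ltrD2l ltrN2.
  have [bm E1 E2 E3] := budget_mix hbeta a01 bp bb0.
  have om : total mu (fun r => a * p r + (1 - a) * p0 r)%R = 1%R.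
    by rewrite E1 o0 o; ring.
  have [dm Hm Mm] := budget_density hst bm om.
  move: Fb1; rewrite ltNge => /negP; apply.
  apply: (@le_trans _ _ (H mu beta (fun r => a * p r + (1 - a) * p0 r)%R)).
    apply: ereal_inf_lbound; eexists; last reflexivity; split=> //.
    by rewrite Mm E2; congr EFin; move: aE; rewrite /b0; lra.
  apply: le_trans Hm _; rewrite E3 g00 lee_fin.
  by case/andP: a01 => a0 a1; nra.
pose S := [set x : R | exists p g, [/\ budget mu beta X p g, total mu p = 1%R,
  (total mu g <= k)%R & x = first_moment mu X p]].
have S0 : S !=set0.
  by exists (first_moment mu X p0), p0, g0; split=> //; rewrite g00 ltW.
have Slb : lbound S b1 by move=> _ [p [g [bp o gk ->]]]; exact: low bp o gk.
have Sinf : has_inf S by split=> //; exists b1.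
pose v := inf S.
have vS x : S x -> (v <= x)%R by move=> Sx; apply: ge_inf => //; case: Sinf.
have b1v : (b1 <= v)%R by apply: lb_le_inf.
have [||lam lam0 hlam] := cost_multiplier hbeta bb0 o0 k0 g00 (v := v).
- by apply: vS; exists p0, g0; split=> //; rewrite g00 ltW.
- by move=> p g bp o gk; apply: vS; exists p, g; split; rewrite ?gk.
have [nu hnu] := mass_multiplier hbeta mX bb0 o0 hlam.
have lamp : (0 < lam)%R.
  rewrite lt_neqAle lam0 andbT eq_sym; apply/eqP => lamE.
  have [num c0] := degenerate_multiplier hbeta mX bb0 hnu lamE.
  have : nu%:E < b1%:E by apply: le_lt_trans num mb1.
  by rewrite lte_fin; move: c0; rewrite lamE; lra.
have SD := strong_duality hbeta mX bb0 hnu lamp.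
exists v, (nu / lam)%R, (- lam^-1)%R; split.
- rewrite /V; apply: (@le_trans _ _ (ereal_inf (EFin @` S))).
    apply: le_ereal_inf_tmp => _ [_ [p [g [bp o gk ->]]] <-].
    have [dp Hp Mp] := budget_density hst bp o.
    apply: ereal_inf_lbound; exists p => //; split=> //.
    by apply: le_trans Hp _; rewrite lee_fin.
  by rewrite ereal_inf_EFin //; case: Sinf.
- by rewrite oppr_lt0 invr_gt0.
have Kf : K mu beta X (nu / lam)%R (- lam^-1)%R \is a fin_num.
  by rewrite fin_real // K_gtNy /=; apply: le_lt_trans SD _; rewrite ltry.
move: SD; rewrite (dual_objectiveE _ (esym (fineK Kf))) -(fineK Kf) !lee_fin.
set z := fine _ => SD; rewrite invrN invrK mulrN -mulNr.
have lz : (lam * z <= - (v + lam * k - nu))%R.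
  by move: SD; rewrite ler_pdivlMr // mulrC.
have -> : (- (k + z - nu / lam) * lam = - (k * lam) - lam * z + nu)%R.
  by field; rewrite gt_eqF.
lra.
Qed.

(** The maximal dual value is at least the v of [V_dual_attained], so K - t1 <=
    t2 v - k, while V(k) <= v bounds the mean of p by v + epsilon. Insert both
    in [Bregman_le]. *)
Lemma almost_worst_case_Bregman (k : R) : (0 < k)%R -> k%:E < kmax mu beta X ->
   forall t1 t2 : R, dual_maximiser mu beta X k t1 t2 ->
   forall epsilon gamma : R, (0 <= epsilon)%R -> (0 <= gamma)%R ->
   forall p, almost_worst_case mu beta X k epsilon gamma p ->
     B mu beta p (p_ beta X t1 t2) <= (gamma - t2 * epsilon)%:E.
Proof.
move=> k0 kk t1 t2 [t20 tmax] eps gam _ _ p [dp Hp Mp].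
have [v [u1 [u2 [Vv u20 vu]]]] := V_dual_attained k0 kk.
have vt : v%:E <= dual_objective mu beta X k t1 t2 by apply: le_trans vu (tmax _ _ u20).
have t2V : (t2^-1 < 0)%R by rewrite invr_lt0.
have Kf : K mu beta X t1 t2 \is a fin_num.
  rewrite fin_real // K_gtNy /= ltey; apply/eqP => Koo.
  move: vt; rewrite /dual_objective Koo /= lt0_mulye ?lte_fin //.
have KE := fineK Kf; set z := fine (K mu beta X t1 t2) in KE.
have zv : (k + z - t1 <= v * t2)%R.
  move: vt; rewrite (dual_objectiveE _ (esym KE)) lee_fin.
  by rewrite -(ler_nM2r t20) -mulrA mulVf ?mulr1 // lt_eqF.
have tmin e : (0 < e)%R -> K mu beta X t1 t2 <= K mu beta X (t1 - e)%R t2 + e%:E.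
  move=> e0; have [->|Koo] := eqVneq (K mu beta X (t1 - e)%R t2) +oo.
    by rewrite addye // leey.
  have Kef : K mu beta X (t1 - e)%R t2 \is a fin_num.
    by rewrite fin_real // K_gtNy /= ltey.
  have := tmax (t1 - e)%R t2 t20.
  rewrite (dual_objectiveE _ (esym KE)) (dual_objectiveE _ (esym (fineK Kef))).
  rewrite -KE -(fineK Kef) -EFinD !lee_fin.
  by rewrite ler_nM2r //; lra.
have Hf : H mu beta p \is a fin_num.
  by apply: (H_fin_num hst dp); apply: le_lt_trans Hp _; rewrite ltry.
have Mf : mean mu X p \is a fin_num.
  rewrite fin_real // (mean_gtNy hst t20 Kf dp Hf) /=.
  apply: le_lt_trans Mp _; apply: (@le_lt_trans _ _ (v%:E + eps%:E)).
    by rewrite leeD2r.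
  by rewrite -EFinD ltry.
have [bp cE xE] := density_budget hst dp Hf Mf.
have [bb0 _ _ _] := default_budget hst.
apply: le_trans (Bregman_le hbeta mX Kf bb0 tmin bp) _.
rewrite (total_density dp) lee_fin.
have : (first_moment mu X p <= v + eps)%R.
  rewrite -lee_fin xE EFinD; apply: le_trans Mp _.
  by rewrite leeD2r.
move: Hp; rewrite -cE lee_fin -/z; nra.
Qed.

(** With w the infimum of the penalised cost over budgets of mass 1, weak
    duality gives K(t1, t2) - t1 >= - w / lambda for all t1, and the mass
    multiplier gives a t1 with equality. Hence the infimum defining G is
    attained and equals - w / lambda, and [Bregman_le] applies to the selected
    minimiser. *)
Lemma penalised_Bregman (lambda : R) : (0 < lambda)%R ->
  Theta2 mu beta X (- lambda^-1)%R ->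
  forall p, density mu p ->
    W mu beta X lambda + lambda%:E * B mu beta p (q_ mu beta X (- lambda^-1)%R)
       <= penalised mu beta X lambda p.
Proof.
move=> lam0 [s1 Ks1] p dp.
have [bb0 o0 g00 _] := default_budget hst.
set t2 := (- lambda^-1)%R; have t20 : (t2 < 0)%R by rewrite oppr_lt0 invr_gt0.
pose S := [set x : R | exists p g, [/\ budget mu beta X p g, total mu p = 1%R &
  x = (first_moment mu X p + lambda * total mu g)%R]].
have S0 : S !=set0 by eexists; exists p0, g0.
have weak t1 z : K mu beta X t1 t2 = z%:E -> lbound S (lambda * (t1 - z))%R.
  move=> Kz _ [q [g [bq oq ->]]].
  have := weak_duality hbeta mX t1 t2 bq; rewrite Kz lee_fin oq mulr1.
  have -> : (t2 * first_moment mu X q = - (first_moment mu X q / lambda))%R.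
    by rewrite /t2 mulNr mulrC.
  set x := first_moment mu X q; set y := total mu g => h.
  have xE : (x = lambda * (x / lambda))%R by rewrite mulrCA mulfV ?mulr1 // gt_eqF.
  rewrite xE -mulrDr ler_pM2l //; lra.
have Kfin t1 : K mu beta X t1 t2 < +oo -> K mu beta X t1 t2 \is a fin_num.
  by move=> Kt; rewrite fin_real // K_gtNy.
have Slb : has_lbound S.
  exists (lambda * (s1 - fine (K mu beta X s1 t2)))%R.
  by apply: weak; rewrite fineK // Kfin.
pose w := inf S.
have wS q g : budget mu beta X q g -> total mu q = 1%R ->
    (w <= first_moment mu X q + lambda * total mu g)%R.
  by move=> bq oq; apply: ge_inf => //; exists q, g.
have [nu hnu] := mass_multiplier hbeta mX bb0 o0 wS.
have SD := strong_duality hbeta mX bb0 hnu lam0.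
have Klow t1 : (t1 - w / lambda)%:E <= K mu beta X t1 t2.
  have [->|Koo] := eqVneq (K mu beta X t1 t2) +oo; first exact: leey.
  have Kf := Kfin t1 ltac:(by rewrite ltey).
  have := lb_le_inf S0 (weak t1 _ (esym (fineK Kf))).
  rewrite -/w -(fineK Kf) lee_fin => h.
  have : (t1 - fine (K mu beta X t1 t2) <= w / lambda)%R.
    by rewrite ler_pdivlMr // mulrC.
  lra.
have Knu : K mu beta X (nu / lambda)%R t2 - (nu / lambda)%:E = (- (w / lambda))%:E.
  have KE : K mu beta X (nu / lambda)%R t2 = (nu / lambda - w / lambda)%:E.
    apply/eqP; rewrite eq_le Klow andbT; apply: le_trans SD _.
    by rewrite lee_fin; lra.
  by rewrite KE -EFinB; congr EFin; ring.
have GE : G mu beta X t2 = (- (w / lambda))%:E.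
  apply/eqP; rewrite eq_le; apply/andP; split.
    by apply: ereal_inf_lbound; exists (nu / lambda)%R.
  apply: le_ereal_inf_tmp => _ [t1 _ <-]; rewrite leeBrDr //.
  by apply: le_trans (Klow t1); rewrite -EFinD lee_fin; lra.
rewrite /q_; set t1 := get _.
have t1E : K mu beta X t1 t2 = (t1 - w / lambda)%:E.
  have : [set t1 : R | K mu beta X t1 t2 - t1%:E = G mu beta X t2] t1.
    by apply: getI (nu / lambda)%R _; rewrite /= Knu GE.
  rewrite /= GE => h.
  by rewrite -[LHS](@subeK _ _ t1%:E) // h -EFinD; congr EFin; lra.
have Kf : K mu beta X t1 t2 \is a fin_num by rewrite t1E.
have tmin e : (0 < e)%R -> K mu beta X t1 t2 <= K mu beta X (t1 - e)%R t2 + e%:E.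
  move=> e0; rewrite t1E; apply: (@le_trans _ _ ((t1 - e - w / lambda)%:E + e%:E)).
    by rewrite -EFinD lee_fin; lra.
  by rewrite leeD2r.
have Ww : W mu beta X lambda <= w%:E.
  apply: (@le_trans _ _ (ereal_inf (EFin @` S))); last by rewrite ereal_inf_EFin.
  apply: le_ereal_inf_tmp => _ [_ [q [g [bq oq ->]]] <-].
  have [dq Hq Mq] := budget_density hst bq oq.
  have Hqo : H mu beta q < +oo by apply: le_lt_trans Hq _; rewrite ltry.
  have Hqf := H_fin_num hst dq Hqo.
  apply: (@le_trans _ _ (penalised mu beta X lambda q)).
    by apply: ereal_inf_lbound; exists q.
  rewrite /penalised lt_eqF // Mq EFinD leeD2l // EFinM lee_pmul2l ?lte_fin //.
rewrite /penalised; case: ifPn => [_|Hoo]; first exact: leey.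
have Hf : H mu beta p \is a fin_num by apply: (H_fin_num hst dp); rewrite ltey.
have [Moo|Moo] := eqVneq (mean mu X p) +oo.
  by rewrite Moo -(fineK Hf) -EFinM addye // leey.
have Mf : mean mu X p \is a fin_num.
  by rewrite fin_real // (mean_gtNy hst t20 Kf dp Hf) /= ltey.
have [bp cE xE] := density_budget hst dp Hf Mf.
have := Bregman_le hbeta mX Kf bb0 tmin bp.
rewrite (total_density dp) t1E /= => Ble.
rewrite -cE -xE; set x := first_moment mu X p; set y := total mu _.
apply: (@le_trans _ _ (w%:E + lambda%:E * (y + (t1 - w / lambda) - t1 * 1 - t2 * x)%:E)).
  by apply: leeD => //; rewrite lee_pmul2l ?lte_fin.
rewrite -!EFinM -!EFinD lee_fin /t2.
have lE : (lambda * (lambda^-1 * x) = x)%R by rewrite mulrA mulfV ?mul1r // gt_eqF.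
have wE : (lambda * (w / lambda) = w)%R by rewrite mulrCA mulfV ?mulr1 // gt_eqF.
nra.
Qed.

End WorstCase.
Theorem theorem2 (d : measure_display) (Omega : measurableType d)
    (R : realType) (mu : {sigma_finite_measure set Omega -> \bar R})
    (beta : Omega -> R -> \bar R) (X p0 : Omega -> R)
    (hst : standing mu beta X p0) :
  (forall k : R, (0 < k)%R -> k%:E < kmax mu beta X ->
   forall t1 t2 : R, dual_maximiser mu beta X k t1 t2 ->
   forall epsilon gamma : R, (0 <= epsilon)%R -> (0 <= gamma)%R ->
   forall p : Omega -> R, almost_worst_case mu beta X k epsilon gamma p ->
     B mu beta p (p_ beta X t1 t2) <= (gamma - t2 * epsilon)%:E)
  /\
  (forall lambda : R, (0 < lambda)%R -> Theta2 mu beta X (- lambda^-1)%R ->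
   forall p : Omega -> R, density mu p ->
     W mu beta X lambda + lambda%:E * B mu beta p (q_ mu beta X (- lambda^-1)%R)
       <= penalised mu beta X lambda p).
Proof.
split=> [k k0 kk|lambda lam0 th]; first exact: (almost_worst_case_Bregman hst).
exact: (penalised_Bregman hst).
Qed.
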